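(* Let $\mathcal T=(\emptyset=\mu_0,\mu_1,\dots,\mu_r)$ be an oscillating tableau, let $(\iota,T)$ be its image under Sundaram's first bijection with $\iota$ a fixed-point-free involution of $A$, let $I$ be the Robinson–Schensted row-insertion tableau of $\iota$, and let $Q$ be the standard tableau obtained by column-inserting the reverse reading word of $I$ into $T$. Let $A_{Rob},\iota_{Rob},T_{Rob},Q_{Rob},I_{Rob}$ be obtained from $\mathcal T$ by Roby's growth diagram construction (described in the context). Then $A_{Rob}=A$, $\iota_{Rob}=\iota$, $T_{Rob}=T$, $I_{Rob}=I$ and $Q_{Rob}=Q$.
   Context: An oscillating tableau of length $r$ is a sequence of partitions $(\emptyset=\mu_0,\dots,\mu_r)$ whose consecutive Ferrers diagrams differ by exactly one box; step $k$ is an expansion or contraction according as the box $b_k$ is added or removed. A partial Young tableau is a filling of a Ferrers shape by distinct positive integers increasing along rows and columns. Column insertion of $x$: insert into the first column; if $x$ exceeds all its entries place it at the bottom, else it replaces the smallest entry larger than $x$, which is inserted into the next column in the same way, etc. Column deletion of the entry $y$ of a corner box in column $j$: remove it, then for columns $j-1,\dots,1$ in turn replace the largest entry smaller than the current $y$ by $y$ and let $y$ be the replaced entry; the final $y$ is the output. Sundaram's first bijection: $\iota_0=T_0=\emptyset$; for $k=1,\dots,r$: on an expansion, $\iota_k=\iota_{k-1}$ and $T_k$ is $T_{k-1}$ with $k$ placed in $b_k$; on a contraction, column-delete the entry of $b_k$ from $T_{k-1}$ giving output $x$ and $T_k$, and $\iota_k=\iota_{k-1}$ with transposition $(x,k)$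 adjoined; $(\iota,T)=(\iota_r,T_r)$. $I$ is the row-insertion tableau of the word $\iota(a_1)\cdots\iota(a_m)$, $A=\{a_1<\dots<a_m\}$. The reverse reading word of $I$ reads the rows of $I$ top to bottom, each right to left. Local rules for a unit cell with corner labels $\lambda$ (lower left), $\mu$ (upper left), $\rho$ (upper right), $\nu$ (lower right); $\lambda\pm\epsilon_i$ denotes adding/removing a box in row $i$. Forward rules: (F1) if $\mu\ne\nu$, $\rho=\mu\cup\nu$; (F2) if $\lambda\ne\mu=\nu$ with $\mu=\lambda+\epsilon_i$, $\rho=\mu+\epsilon_{i+1}$; (F3) if $\lambda=\mu=\nu$, $\rho=\lambda$ if the cell is empty and $\rho=\lambda+\epsilon_1$ if it contains a cross. Backward rules: (B1) if $\mu\ne\nu$, $\lambda=\mu\cap\nu$ and the cell is empty; (B2) if $\rho\ne\mu=\nu$ with $\mu=\rho-\epsilon_i$: if $i=1$ then $\lambda=\mu$ and the cell gets a cross, if $i\ge2$ then $\lambda=\mu-\epsilon_{i-1}$ and the cell is empty; (B3) if $\rho=\mu=\nu$ then $\lambda=\mu$ and the cell is empty. Roby's construction: take lattice points $(x,y)$, $0\le x,y\le r$, and the $r^2$ unit cells; the cell with upper-right corner $(x,y)$ is said to lie in column $x$ and row $r+1-y$ (rows numbered from the top, as in a matrix). (R1) Label the point $(k,r-k)$ by the conjugate $\mu_k^t$, $k=0,\dots,r$. (R2) Determine the labels of all points with $x+y<r$ and the contents of all cells with upper-right corner satisfying $x+y\le r+1$ by the backward rules (cells straddling the diagonal fall under B1).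 (R3) Put a cross in the cell in row $i$, column $j$ above the diagonal whenever the cell in row $j$, column $i$ contains a cross. (R4) Determine the labels of all points with $x+y>r$ by the forward rules. Let $\tau_k$ and $\kappa_k$ be the labels of $(k,0)$ and $(k,r)$. Then $A_{Rob}$ is the set of column indices of cells containing crosses; $\iota_{Rob}(j)=i$ whenever the cell in column $j$, row $i$ contains a cross. A sequence $(\emptyset=\epsilon_0,\dots,\epsilon_r)$ of partitions with each $\epsilon_k$ equal to $\epsilon_{k-1}$ or obtained from it by adding one box determines the partial tableau having $k$ in the box added at step $k$ (and not containing $k$ if $\epsilon_k=\epsilon_{k-1}$). $T_{Rob}$ and $Q_{Rob}$ are the partial tableaux determined by $(\tau_k^t)_k$ and $(\kappa_k^t)_k$. For $I_{Rob}$: take a fresh $r\times r$ grid with crosses in the same cells, label all points on the lower border ($y=0$) and left border ($x=0$) by $\emptyset$, compute all other labels by the forward rules, let $\nu_k$ be the label of $(k,r)$, and let $I_{Rob}$ be the partial tableau determined by $(\nu_k^t)_k$. *)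

(* Defs.v *)
From mathcomp Require Import all_boot.
Set Implicit Arguments. Unset Strict Implicit. Unset Printing Implicit Defensive.

Definition part := seq nat.
Definition tab := seq (seq nat).   (* tableau, list of rows top to bottom *)

Definition is_part (l : part) : bool :=
  sorted (fun a b => b <= a) l && all (fun a => 0 < a) l.

Definition conj (l : part) : part :=
  mkseq (fun j => count (fun a => j < a) l) (head 0 l).

Definition diffrow (a b : part) : nat :=
  find (fun i => nth 0 a i != nth 0 b i) (iota 0 (size a + size b)).

Definition add_row (l : part) (i : nat) : part := incr_nth l i.
Definition rem_row (l : part) (i : nat) : part :=
  [seq a <- set_nth 0 l i (nth 0 l i).-1 | a != 0].

Definition pmeet (a b : part) : part :=
  mkseq (fun i => minn (nth 0 a i) (nth 0 b i)) (minn (size a) (size b)).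
Definition pjoin (a b : part) : part :=
  mkseq (fun i => maxn (nth 0 a i) (nth 0 b i)) (maxn (size a) (size b)).

Definition one_box (a b : part) : bool :=
  is_part b && has (fun i => b == add_row a i) (iota 0 (size a).+1).

Definition osc_step (a b : part) : bool := one_box a b || one_box b a.

Definition osc_tableau (mu : seq part) : bool :=
  [&& 0 < size mu, nth [::] mu 0 == [::], all is_part mu & sorted osc_step mu].

Definition len (mu : seq part) : nat := (size mu).-1.
Definition muk (mu : seq part) (k : nat) : part := nth [::] mu k.

(* transposition (rows <-> columns); drops empty rows/columns *)
Definition trans (T : tab) : tab :=
  mkseq (fun j => [seq nth 0 row j | row <- T & j < size row])
        (foldr maxn 0 (map size T)).

Fixpoint rowins (x : nat) (T : tab) : tab :=
  match T with
  | [::] => [:: [:: x]]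
  | row :: rest =>
      if has (fun a => x < a) row then
        let z := nth 0 [seq a <- row | x < a] 0 in
        [seq (if a == z then x else a) | a <- row] :: rowins z rest
      else rcons row x :: rest
  end.

Definition colins (x : nat) (T : tab) : tab := trans (rowins x (trans T)).

Fixpoint bump_back (cols : tab) (k : nat) (y : nat) : tab * nat :=
  match k with
  | 0 => (cols, y)
  | k'.+1 =>
      let col := nth [::] cols k' in
      let z := last 0 [seq a <- col | a < y] in
      bump_back (set_nth [::] cols k' [seq (if a == z then y else a) | a <- col]) k' z
  end.

Definition coldel (T : tab) (c : nat) : tab * nat :=
  let C := trans T in
  let col := nth [::] C c in
  let y := last 0 col in
  let C1 := set_nth [::] C c (take (size col).-1 col) in
  let (C2, x) := bump_back C1 c y in (trans C2, x).

Definition tab_add (T : tab) (i v : nat) : tab :=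
  if i < size T then set_nth [::] T i (rcons (nth [::] T i) v) else rcons T [:: v].

Definition sund_step (mu : seq part) (st : seq (nat * nat) * tab) (k : nat)
  : seq (nat * nat) * tab :=
  let l := muk mu k.-1 in
  let n := muk mu k in
  let i := diffrow l n in
  if sumn l < sumn n then (st.1, tab_add st.2 i k)
  else let (T', x) := coldel st.2 (nth 0 l i).-1 in (rcons st.1 (x, k), T').

Definition sundaram (mu : seq part) : seq (nat * nat) * tab :=
  foldl (sund_step mu) ([::], [::]) (iota 1 (len mu)).

(* iota as a list of transpositions (x,k) *)
Definition sund_pairs (mu : seq part) := (sundaram mu).1.
Definition sund_T (mu : seq part) : tab := (sundaram mu).2.

Definition pair_elems (ps : seq (nat * nat)) : seq nat :=
  flatten [seq [:: p.1; p.2] | p <- ps].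
(* the transpositions are disjoint and non-trivial: fixed-point-free involution of A *)
Definition fpf_involution (ps : seq (nat * nat)) : bool := uniq (pair_elems ps).
Definition supp (ps : seq (nat * nat)) : seq nat := sort leq (pair_elems ps).
Definition partner (ps : seq (nat * nat)) (a : nat) : nat :=
  foldr (fun p acc => if p.1 == a then p.2 else if p.2 == a then p.1 else acc) a ps.
Definition is_pair (ps : seq (nat * nat)) (i j : nat) : bool :=
  ((i, j) \in ps) || ((j, i) \in ps).

Definition I_tab (mu : seq part) : tab :=
  let ps := sund_pairs mu in
  foldl (fun T a => rowins a T) [::] [seq partner ps a | a <- supp ps].

Definition rev_reading (I : tab) : seq nat := flatten (map rev I).

Definition Q_tab (mu : seq part) : tab :=
  foldl (fun T x => colins x T) (sund_T mu) (rev_reading (I_tab mu)).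

(* forward: lambda (lower left), mu (upper left), nu (lower right), cross -> rho *)
Definition fwd (l m n : part) (c : bool) : part :=
  if m != n then pjoin m n
  else if l != m then add_row m (diffrow l m).+1
  else if c then add_row l 0 else l.

(* backward: mu (upper left), nu (lower right), rho (upper right) -> (lambda, cross) *)
Definition bwd (m n p : part) : part * bool :=
  if m != n then (pmeet m n, false)
  else if p != m then
    let i := diffrow m p in
    if i == 0 then (m, true) else (rem_row m i.-1, false)
  else (m, false).

(* Labels are stored as lists indexed by the x-coordinate (entries 0..r),
   read with nth [::]. *)
Definition at_ (l : seq part) (x : nat) : part := nth [::] l x.

(* level d below the antidiagonal: entry x = label of the point (x, r-d-x).
   lowpair d = (level d, level d+1). *)
Fixpoint lowpair (mu : seq part) (d : nat) : seq part * seq part :=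
  let r := len mu in
  match d with
  | 0 => (mkseq (fun x => conj (muk mu x)) r.+1,
          mkseq (fun x => pmeet (conj (muk mu x)) (conj (muk mu x.+1))) r.+1)
                                                  (* cells straddling the diagonal: B1 *)
  | d'.+1 =>
      let pr := lowpair mu d' in
      (pr.2, mkseq (fun x => (bwd (at_ pr.2 x) (at_ pr.2 x.+1) (at_ pr.1 x.+1)).1) r.+1)
  end.
Definition low (mu : seq part) (d x : nat) : part := at_ (lowpair mu d).1 x.

(* content of the cell in row i, column j with i > j (below the diagonal):
   its upper-right corner is (j, r+1-i), lower-left corner (j-1, r-i), on level i-j+1 *)
Definition lowcross (mu : seq part) (i j : nat) : bool :=
  let d' := i - j - 1 in
  let x := j.-1 in
  (bwd (low mu d'.+1 x) (low mu d'.+1 x.+1) (low mu d' x.+1)).2.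

(* crosses after R2 and R3; rows/columns numbered 1..r *)
Definition rob_cross (mu : seq part) (i j : nat) : bool :=
  [&& 0 < i, i <= len mu, 0 < j, j <= len mu &
      if j < i then lowcross mu i j
      else if i < j then lowcross mu j i else false].

(* level e above the antidiagonal: entry x = label of (x, r+e-x).
   highpair e = (level e-1, level e), level -1 = low 1, level 0 = low 0.
   The cell with upper-right corner (x, r+e-x) lies in row x-e+1, column x. *)
Fixpoint highpair (mu : seq part) (e : nat) : seq part * seq part :=
  let r := len mu in
  match e with
  | 0 => ((lowpair mu 1).1, (lowpair mu 0).1)
  | e'.+1 =>
      let pr := highpair mu e' in
      (pr.2, mkseq (fun x => fwd (at_ pr.1 x.-1) (at_ pr.2 x.-1) (at_ pr.2 x)
                                 (rob_cross mu (x - e') x)) r.+1)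
  end.
Definition high (mu : seq part) (e x : nat) : part := at_ (highpair mu e).2 x.

Definition tau (mu : seq part) (k : nat) : part := low mu (len mu - k) k.    (* label of (k,0) *)
Definition kappa (mu : seq part) (k : nat) : part := high mu k k.           (* label of (k,r) *)

Definition A_Rob (mu : seq part) : seq nat :=
  [seq j <- iota 1 (len mu) | has (fun i => rob_cross mu i j) (iota 1 (len mu))].

(* fresh grid, borders labelled by the empty partition, forward rules everywhere.
   grid x = labels of (x, 0), ..., (x, r); the cell with upper-right corner
   (x, y+1) lies in row r-y, column x. *)
Definition gcol (mu : seq part) (prev : seq part) (x : nat) : seq part :=
  foldl (fun col y => rcons col (fwd (at_ prev y) (at_ prev y.+1) (at_ col y)
                                     (rob_cross mu (len mu - y) x)))
        [:: [::]] (iota 0 (len mu)).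
Fixpoint grid (mu : seq part) (x : nat) : seq part :=
  match x with
  | 0 => nseq (len mu).+1 [::]
  | x'.+1 => gcol mu (grid mu x') x
  end.
Definition nuI (mu : seq part) (k : nat) : part := at_ (grid mu k) (len mu).   (* label of (k,r) *)

Definition chain_ok (eps : seq part) : bool :=
  [&& 0 < size eps, nth [::] eps 0 == [::], all is_part eps &
      all (fun k => (nth [::] eps k == nth [::] eps k.-1)
                    || one_box (nth [::] eps k.-1) (nth [::] eps k))
          (iota 1 (size eps).-1)].

Definition tab_of_chain (eps : seq part) : tab :=
  foldl (fun T k =>
           let a := nth [::] eps k.-1 in let b := nth [::] eps k in
           if b != a then tab_add T (diffrow a b) k else T)
        [::] (iota 1 (size eps).-1).

Definition determines (eps : seq part) (T : tab) : bool :=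
  chain_ok eps && (T == tab_of_chain eps).

Definition T_chain (mu : seq part) := mkseq (fun k => conj (tau mu k)) (len mu).+1.
Definition Q_chain (mu : seq part) := mkseq (fun k => conj (kappa mu k)) (len mu).+1.
Definition I_chain (mu : seq part) := mkseq (fun k => conj (nuI mu k)) (len mu).+1.

(* Main.v *)
(** Transposing all tableaux, column insertion becomes row insertion and the labels of a
    horizontal line of the growth diagram are the shapes of the entries [<= k] of one
    tableau.  Passing to the next line inserts the column index of the cross (forward rules)
    or deletes an entry (backward rules), as seen by tracking where the largest entry goes.
    Below the antidiagonal this is Sundaram's algorithm; read from the bottom line upwards
    the whole diagram column-inserts the reversed word [w] of [iota] into [T].

    Row and column insertion commute: at each step the four shapes of a tableau and of its
    images form a cube in which the added boxes are distinct, or coincide and the next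
    box is adjacent to them.  Hence column-inserting the reversed [w] into the empty
    tableau gives the row insertion tableau [I] of [w], and column-inserting it into [T]
    gives the row insertion of the reading word of [T] into [I].  The latter depends on [w]
    only through [I], so [w] may be replaced by the reading word of [I]. *)
Require Import Defs.
From mathcomp Require Import all_boot.
From mathcomp Require Import zify.
Set Implicit Arguments. Unset Strict Implicit. Unset Printing Implicit Defensive.

(** * Partitions and boxes *)

(** Boxes are pairs (row, column) counted from 0. The default 0 of [nth] puts every box beyond the
    last row outside the diagram. *)
Definition inp (l : part) (b : nat * nat) : bool := b.2 < nth 0 l b.1.

Lemma inpE l i j : inp l (i, j) = (j < nth 0 l i).
Proof. by []. Qed.

Lemma leq_nth_part l i j : is_part l -> i <= j -> nth 0 l j <= nth 0 l i.
Proof.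
case/andP=> sl _ ij.
case: (ltnP j (size l)) => [js|js]; last by rewrite nth_default.
apply: (@sorted_leq_nth _ (fun a b => b <= a)) => //.
- by move=> a b c ab bc; apply: leq_trans bc ab.
- by rewrite inE (leq_ltn_trans ij).
Qed.

Lemma nth_part_gt0 l i : is_part l -> (0 < nth 0 l i) = (i < size l).
Proof.
case/andP=> _ /all_nthP pl.
by case: (ltnP i (size l)) => [/(pl 0)|is_]; last rewrite nth_default.
Qed.

Lemma is_partI l :
  (forall i, nth 0 l i.+1 <= nth 0 l i) ->
  (forall i, i < size l -> 0 < nth 0 l i) -> is_part l.
Proof.
move=> l1 l2; apply/andP; split; first by apply/(sortedP 0)=> i _; apply: l1.
by apply/(all_nthP 0).
Qed.

Lemma eq_part l m : is_part l -> is_part m -> nth 0 l =1 nth 0 m -> l = m.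
Proof.
move=> pl pm e; apply: (@eq_from_nth _ 0) => [|i _]; last exact: e.
have h k : (k < size l) = (k < size m) by rewrite -!nth_part_gt0 // e.
have := h (size l); have := h (size m); lia.
Qed.

Lemma eq_inp l m : is_part l -> is_part m -> inp l =1 inp m -> l = m.
Proof.
move=> pl pm e; apply: eq_part => // i.
have := e (i, nth 0 l i); have := e (i, nth 0 m i); rewrite /inp /=; lia.
Qed.

Lemma inp_le l i j i' j' :
  is_part l -> inp l (i, j) -> i' <= i -> j' <= j -> inp l (i', j').
Proof.
by rewrite /inp /= => pl lt_j /(leq_nth_part pl); lia.
Qed.

(** The covering relation of Young's lattice with the added box as a parameter. Stating it by
    membership of boxes reduces joins, meets and conjugation to boolean identities. *)
Definition cov (l : part) (b : nat * nat) (l' : part) : Prop :=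
  [/\ is_part l, is_part l', ~~ inp l b & forall c, inp l' c = inp l c || (c == b)].

Lemma cov_nth l i j l' : cov l (i, j) l' ->
  nth 0 l i = j /\ forall k, nth 0 l' k = nth 0 l k + (k == i).
Proof.
case=> _ _; rewrite inpE => nl e.
have ei : nth 0 l i = j.
  have := e (i, j); have := e (i, nth 0 l i); rewrite !inpE !xpair_eqE !eqxx /=; lia.
split=> // k.
have := e (k, nth 0 l k); have := e (k, (nth 0 l' k).-1).
have := e (k, nth 0 l' k); have := e (k, (nth 0 l k).+1).
have := e (k, (nth 0 l k).-1).
rewrite !inpE !xpair_eqE /=; case: eqP => [->|_] /=; lia.
Qed.

Lemma covI l l' i : is_part l -> is_part l' ->
  (forall k, nth 0 l' k = nth 0 l k + (k == i)) -> cov l (i, nth 0 l i) l'.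
Proof.
move=> pl pl' e; split=> //; rewrite ?inpE ?ltnn // => -[k c].
rewrite !inpE e xpair_eqE /=; case: eqP => [->|_] /=; lia.
Qed.

Lemma cov_incr l i j l' : cov l (i, j) l' -> l' = incr_nth l i.
Proof.
move=> cl; have [e1 e2] := cov_nth cl; have [pl pl' _ _] := cl.
have le_i : i <= size l.
  case: i e1 e2 {cl} => // i _ e2; rewrite -(nth_part_gt0 _ pl).
  have := leq_nth_part pl' (leqnSn i); rewrite !e2 eqxx; lia.
apply: (@eq_from_nth _ 0) => [|k _]; last by rewrite e2 nth_incr_nth addnC eq_sym.
have h k : (k < size l') = (k < size l) || (k == i).
  rewrite -(nth_part_gt0 _ pl') e2 -(nth_part_gt0 _ pl); lia.
have := h (size l'); have := h (size l); have := h i; have := h (size l').-1.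
rewrite size_incr_nth; case: (ltnP i (size l)); lia.
Qed.

Lemma incr_cov l i : is_part l -> i <= size l ->
  (0 < i -> nth 0 l i < nth 0 l i.-1) -> cov l (i, nth 0 l i) (incr_nth l i).
Proof.
move=> pl si li; apply: covI => // [|k]; last by rewrite nth_incr_nth addnC eq_sym.
apply: is_partI => k.
  rewrite !nth_incr_nth; have := leq_nth_part pl (leqnSn k).
  case: (eqVneq i k.+1) li => [-> /(_ isT)|_ _] /=; lia.
rewrite size_incr_nth nth_incr_nth.
have := nth_part_gt0 k pl; case: (eqVneq i k) => //= ik; case: (ltnP i (size l)); lia.
Qed.

Lemma cov_size_le l i j m : cov l (i, j) m -> i <= size l.
Proof.
move=> hb; have [_ e] := cov_nth hb.
have [pl pl' _ _] := hb; case: i hb e => // i hb e; rewrite -(nth_part_gt0 _ pl).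
have := leq_nth_part pl' (leqnSn i); rewrite !e eqxx; lia.
Qed.

Lemma find_first (P : pred nat) n i : i < n -> P i -> (forall k, k < i -> ~~ P k) ->
  find P (iota 0 n) = i.
Proof.
move=> lt_in Pi Pk; have hP : has P (iota 0 n).
  by apply/hasP; exists i => //; rewrite mem_iota.
have lt_f : find P (iota 0 n) < n by rewrite -[X in _ < X](size_iota 0) -has_find.
have := nth_find 0 hP; rewrite nth_iota // add0n => Pf.
case: (ltngtP (find P (iota 0 n)) i) => // [/Pk|lt_i]; first by rewrite Pf.
by have := before_find 0 lt_i; rewrite nth_iota // add0n Pi.
Qed.

Lemma cov_diffrow l b l' : cov l b l' -> diffrow l l' = b.1 /\ diffrow l' l = b.1.
Proof.
case: b => i j cl; have [e1 e2] := cov_nth cl; have [pl pl' _ _] := cl.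
have lt_i : i < size l' by rewrite -(nth_part_gt0 _ pl') e2 eqxx; lia.
have neq k : (nth 0 l k != nth 0 l' k) = (k == i).
  by rewrite e2; case: (k == i); lia.
split=> /=; apply: find_first; rewrite ?(eq_sym (nth 0 l' _)) ?neq ?eqxx //; try lia.
- by move=> k lt_k; rewrite neq; lia.
- by move=> k lt_k; rewrite eq_sym neq; lia.
Qed.

Lemma cov_fun l b l1 l2 : cov l b l1 -> cov l b l2 -> l1 = l2.
Proof.
by move=> [_ p1 _ e1] [_ p2 _ e2]; apply: eq_inp => // c; rewrite e1 e2.
Qed.

Lemma cov_box l i j j' l1 l2 : cov l (i, j) l1 -> cov l (i, j') l2 -> j = j'.
Proof. by move=> /cov_nth[<- _] /cov_nth[<- _]. Qed.

Lemma cov_neq l b l' : cov l b l' -> (l == l') = false.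
Proof. by move=> [_ _ n e]; apply/eqP=> E; move: (e b); rewrite -E eqxx (negPf n). Qed.

Lemma nth_conj l j : is_part l -> nth 0 (conj l) j = count (fun a => j < a) l.
Proof.
move=> pl; rewrite /conj; case: (ltnP j (head 0 l)) => h; first by rewrite nth_mkseq.
rewrite nth_default ?size_mkseq //; apply/esym/eqP; rewrite -leqn0 leqNgt -has_count.
apply/hasPn => a /(nthP 0)[i _ <-]; rewrite -leqNgt.
by apply: leq_trans h; rewrite -nth0 leq_nth_part.
Qed.

(** Row lengths decrease, so the rows longer than [j] come first; their number exceeds [i] exactly
    when row [i] is one of them. *)
Lemma inp_conj l i j : is_part l -> inp (conj l) (j, i) = inp l (i, j).
Proof.
move=> pl; rewrite /inp /= nth_conj //.
elim: l pl i => [|a l IH] pl i; first by rewrite nth_nil.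
have pl' : is_part l.
  by case/andP: pl => /path_sorted s /andP[_ p]; apply/andP.
case: i => [|i] /=.
  case: (ltnP j a) => [//|le_a]; rewrite add0n -has_count.
  apply/hasPn => b /(nthP 0)[i _ <-]; rewrite -leqNgt; apply: leq_trans le_a.
  exact: (@leq_nth_part (a :: l) 0 i.+1).
rewrite -IH //; case: (ltnP j a) => //= le_a.
have -> : count (fun b => j < b) l = 0; last by [].
apply/eqP; rewrite -leqn0 leqNgt -has_count.
apply/hasPn => b /(nthP 0)[k _ <-]; rewrite -leqNgt; apply: leq_trans le_a.
exact: (@leq_nth_part (a :: l) 0 k.+1).
Qed.

Lemma conj_part l : is_part l -> is_part (conj l).
Proof.
move=> pl; apply: is_partI => j.
  by rewrite !nth_conj //; apply: sub_count => a /ltnW.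
rewrite size_mkseq nth_conj // => lt_j.
case: l pl lt_j => //= a l _ -> //.
Qed.

Lemma conjK l : is_part l -> conj (conj l) = l.
Proof.
move=> pl; apply: eq_inp => //; first by do 2!apply: conj_part.
by case=> i j; rewrite !inp_conj ?conj_part.
Qed.

Lemma cov_conj l i j l' : cov l (i, j) l' -> cov (conj l) (j, i) (conj l').
Proof.
move=> [pl pl' n e]; split; rewrite ?conj_part ?inp_conj // => -[c d].
by rewrite !inp_conj // e !xpair_eqE andbC.
Qed.

Lemma cov_sumn l b l' : cov l b l' -> sumn l' = (sumn l).+1.
Proof.
by case: b => i j /cov_incr ->; elim: l i => [|a l IH] [|i] //=; rewrite ?IH; try lia;
  elim: i => //= i ->.
Qed.

Lemma one_boxP a b : is_part a -> one_box a b -> exists c, cov a c b.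
Proof.
move=> pa /andP[pb /hasP[i _ /eqP e]]; exists (i, nth 0 a i); apply: covI => // k.
by rewrite e nth_incr_nth addnC eq_sym.
Qed.

Lemma cov_one_box a c b : cov a c b -> one_box a b.
Proof.
case: c => i j cab; have [pa pb _ _] := cab; rewrite /one_box pb andTb.
apply/hasP; exists i; last by rewrite (cov_incr cab) eqxx.
rewrite mem_iota; case: i cab => // i cab.
rewrite add0n ltnS -(nth_part_gt0 _ pa).
have [_ e] := cov_nth cab.
have := leq_nth_part pb (leqnSn i); rewrite !e eqxx; lia.
Qed.

(** * Local rules *)

Lemma nth_pjoin a b i : nth 0 (pjoin a b) i = maxn (nth 0 a i) (nth 0 b i).
Proof.
case: (ltnP i (maxn (size a) (size b))) => h; first by rewrite nth_mkseq.
by rewrite !nth_default ?size_mkseq //; lia.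
Qed.

Lemma nth_pmeet a b i : nth 0 (pmeet a b) i = minn (nth 0 a i) (nth 0 b i).
Proof.
case: (ltnP i (minn (size a) (size b))) => h; first by rewrite nth_mkseq.
rewrite nth_default ?size_mkseq //.
case: (leqP (size a) i) => ha; first by rewrite (nth_default _ ha) min0n.
by rewrite (nth_default _ (_ : size b <= i)) ?minn0 //; lia.
Qed.

Lemma pjoin_part a b : is_part a -> is_part b -> is_part (pjoin a b).
Proof.
move=> pa pb; apply: is_partI => i; rewrite !nth_pjoin.
  by have := leq_nth_part pa (leqnSn i); have := leq_nth_part pb (leqnSn i); lia.
by rewrite size_mkseq; have := nth_part_gt0 i pa; have := nth_part_gt0 i pb; lia.
Qed.

Lemma pmeet_part a b : is_part a -> is_part b -> is_part (pmeet a b).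
Proof.
move=> pa pb; apply: is_partI => i; rewrite !nth_pmeet.
  by have := leq_nth_part pa (leqnSn i); have := leq_nth_part pb (leqnSn i); lia.
by rewrite size_mkseq; have := nth_part_gt0 i pa; have := nth_part_gt0 i pb; lia.
Qed.

Lemma inp_pjoin a b c : inp (pjoin a b) c = inp a c || inp b c.
Proof. by rewrite /inp nth_pjoin leq_max. Qed.

Lemma inp_pmeet a b c : inp (pmeet a b) c = inp a c && inp b c.
Proof. by rewrite /inp nth_pmeet leq_min. Qed.

Lemma nth_filter_neq0 s k : (forall i, nth 0 s i.+1 <= nth 0 s i) ->
  nth 0 [seq a <- s | a != 0] k = nth 0 s k.
Proof.
elim: s k => // a s IH k hs /=.
have hs' i : nth 0 s i.+1 <= nth 0 s i by apply: (hs i.+1).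
case: eqP => [a0|_] /=; last by case: k => //= k; apply: IH.
have z i : nth 0 s i = 0.
  by elim: i => [|i IHi]; [have := hs 0 | have := hs' i]; rewrite /= ?a0 ?IHi; lia.
by rewrite IH // z; case: k => [|k] /=; rewrite ?z ?a0.
Qed.

(** Room for a box in row [i.+1] of [m] means that row [i] is strictly longer, so its last box can
    be removed. This makes rule B2 produce a partition. *)
Lemma rem_row_cov m i j p : cov m (i.+1, j) p ->
  cov (rem_row m i) (i, nth 0 (rem_row m i) i) m.
Proof.
move=> cm; have [pm pp _ _] := cm; have [e1 e2] := cov_nth cm.
have h : nth 0 m i.+1 < nth 0 m i.
  have := leq_nth_part pp (leqnSn i); rewrite !e2 eqxx (_ : (i == i.+1) = false) //; lia.
have hd k : nth 0 (set_nth 0 m i (nth 0 m i).-1) k.+1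
         <= nth 0 (set_nth 0 m i (nth 0 m i).-1) k.
  rewrite !nth_set_nth /=; have := leq_nth_part pm (leqnSn k).
  case: (eqVneq k i) => [ki|ki]; case: (eqVneq k.+1 i) => [ki1|ki1]; try subst i; lia.
have e k : nth 0 m k = nth 0 (rem_row m i) k + (k == i).
  rewrite nth_filter_neq0 // nth_set_nth /=; case: eqP => [->|_]; lia.
apply: covI => //; apply: is_partI => k.
  by rewrite !nth_filter_neq0.
by move/(mem_nth 0); rewrite mem_filter lt0n => /andP[].
Qed.

Definition step (l m : part) : Prop := is_part l /\ (m = l \/ exists b, cov l b m).

(* The corners are [l] (lower left), [m] (upper left), [n] (lower right), [p] (upper right). *)
Inductive cell (l m n : part) : part -> bool -> Prop :=
  | cell_id of is_part l & m = l & n = l : cell l m n l false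
  | cell_cross j p of m = l & n = l & cov l (0, j) p : cell l m n p true
  | cell_right b of m = l & cov l b n : cell l m n n false
  | cell_up a of cov l a m & n = l : cell l m n m false
  | cell_join a b p of a != b & cov l a m & cov l b n & cov m b p & cov n a p :
      cell l m n p false
  | cell_bump i j j' p of cov l (i, j) m & n = m & cov m (i.+1, j') p :
      cell l m n p false.

Lemma cov_part l b m : cov l b m -> is_part l /\ is_part m.
Proof. by case. Qed.

Lemma step_part l m : step l m -> is_part m.
Proof. by case=> pl [->|[b /cov_part[]]]. Qed.

Lemma step_refl l : is_part l -> step l l.
Proof. by move=> pl; split; [|left]. Qed.

Lemma cov_step l b m : cov l b m -> step l m.
Proof. by move=> c; split; [case: c|right; exists b]. Qed.
#[local] Hint Resolve cov_step : core.

Lemma cov_cov_neq l a b m n : a != b -> cov l a m -> cov l b n -> (m == n) = false.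
Proof.
move=> ab [_ _ n1 e1] [_ _ n2 e2]; apply/eqP=> E.
by have := e1 a; rewrite E e2 eqxx (negPf ab) (negPf n1).
Qed.

(** The six kinds of [cell] form the graph of the forward rules; combined with [bwdP], the forward
    rules recover the upper right label from which the backward rules started. *)
Lemma fwdE l m n p c : cell l m n p c -> fwd l m n c = p.
Proof.
case=> [pl -> -> | j {}p -> -> /[dup] h /cov_incr -> | b -> h | a h ->
  | a b {}p ab h1 h2 h3 h4 | i j j' {}p h1 -> h2];
  rewrite /fwd ?eqxx //=.
- rewrite (cov_neq h) /=; have [p1 p2 _ e] := h.
  by apply: eq_inp => //; [apply: pjoin_part | move=> c'; rewrite inp_pjoin e; case: inp].
- rewrite eq_sym (cov_neq h) /=; have [p1 p2 _ e] := h.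
  by apply: eq_inp => //; [apply: pjoin_part |
    move=> c'; rewrite inp_pjoin e; case: inp => //=; rewrite orbF].
- rewrite (cov_cov_neq ab h1 h2) /=.
  have [_ p1 _ e1] := h1; have [_ p2 _ e2] := h2; have [_ p3 _ e3] := h3.
  apply: eq_inp => //; [exact: pjoin_part | move=> c'].
  by rewrite inp_pjoin e3 e1 e2; case: inp => //=; case: eqP.
- by rewrite (cov_neq h1) /= (cov_incr h2) (cov_diffrow h1).1.
Qed.

Lemma cov_inj a m n p : cov m a p -> cov n a p -> m = n.
Proof.
move=> [p1 _ n1 e1] [p2 _ n2 e2]; apply: eq_inp => // c.
have := e1 c; rewrite e2; case: eqP => [->|_]; last by rewrite !orbF.
by rewrite (negPf n1) (negPf n2).
Qed.

Lemma bwdP m n p : step m p -> step n p ->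
  exists l c, bwd m n p = (l, c) /\ cell l m n p c.
Proof.
move=> [pm hm] [pn hn].
case: hm hn => [->|[a ha]] [En|[b hb]].
- by exists m, false; rewrite -En /bwd !eqxx /=; split=> //; apply: cell_id.
- have [_ _ _ e] := hb; exists n, false; rewrite /bwd eq_sym (cov_neq hb) /=; split.
    congr pair; apply: eq_inp; rewrite ?pmeet_part // => c.
    by rewrite inp_pmeet e; case: (inp n c); rewrite ?andbF.
  exact: cell_up hb _.
- rewrite En in ha *; have [_ _ _ e] := ha; exists m, false.
  rewrite /bwd (cov_neq ha) /=; split; last exact: cell_right ha.
  congr pair; apply: eq_inp; rewrite ?pmeet_part // => c.
  by rewrite inp_pmeet e; case: (inp m c).
have [_ pp n1 e1] := ha; have [_ _ n2 e2] := hb.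
case: (eqVneq a b) => [ab|ab]; last first.
  exists (pmeet m n), false; rewrite /bwd.
  have -> /= : m != n.
    by apply/eqP=> E; have := e2 a; rewrite e1 eqxx (negPf ab) -E (negPf n1).
  split=> //; have ab' := ab; rewrite eq_sym in ab'.
  apply: (@cell_join _ _ _ b a) => //; split;
    rewrite ?pmeet_part ?inp_pmeet // ?(negPf n1) ?(negPf n2) ?andbF // => c.
    rewrite inp_pmeet; have := e1 c; rewrite e2.
    case: (eqVneq c b) => [->|_]; last by rewrite !orbF => ->; case: (inp m c).
    by rewrite (negPf ab') !orbT !orbF.
  rewrite inp_pmeet; have := e2 c; rewrite e1.
  case: (eqVneq c a) => [->|_]; last by rewrite !orbF => ->; case: (inp n c); rewrite ?andbF.
  by rewrite (negPf ab) !orbT !orbF.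
move: hb; rewrite -ab => hb; have E := cov_inj ha hb; rewrite -E /bwd eqxx eq_sym (cov_neq ha) /=.
rewrite (cov_diffrow ha).1; case: a ha {hb ab n1 e1} => [[|i] j] ha /=.
  by exists m, true; split=> //; apply: cell_cross ha.
have c1 := rem_row_cov ha.
by exists (rem_row m i), false; split=> //; apply: (cell_bump c1 _ ha).
Qed.

Lemma fwd_cell l m n (c : bool) : step l m -> step l n -> (c -> m = l /\ n = l) ->
  cell l m n (fwd l m n c) c.
Proof.
move=> [pl hm] [_ hn] hc.
suff [p hp] : exists p, cell l m n p c by rewrite (fwdE hp).
case: c hc => [/(_ isT)[-> ->]|_].
  by exists (incr_nth l 0); apply: (@cell_cross _ _ _ (nth 0 l 0)) => //; apply: incr_cov.
case: hm hn => [->|[a ha]] [->|[b hb]].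
- by exists l; apply: cell_id.
- by exists n; apply: cell_right hb.
- by exists m; apply: cell_up ha _.
have [_ pm n1 e1] := ha; have [_ pn n2 e2] := hb.
case: (eqVneq a b) => [ab|ab]; last first.
  exists (pjoin m n); have ab' := ab; rewrite eq_sym in ab'.
  apply: (cell_join ab ha hb); split;
    rewrite ?pjoin_part ?e1 ?e2 ?(negPf n1) ?(negPf n2) ?(negPf ab) ?(negPf ab') // => c;
    by rewrite inp_pjoin e1 e2; case: inp => //=; case: (c == a); case: (c == b).
rewrite -ab in hb; rewrite (cov_fun hb ha).
case: a ha {hb ab e1 n1} => i j ha.
(* Row [i] of [m] has just become strictly longer than row [i.+1], so row [i.+1] can take a box. *)
exists (incr_nth m i.+1); apply: (cell_bump ha) => //.
have [h1 h2] := cov_nth ha.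
apply: incr_cov => // [|_]; first by rewrite -(nth_part_gt0 _ pm) h2 eqxx; lia.
rewrite !h2 /=; have := leq_nth_part pl (leqnSn i); rewrite eqxx; lia.
Qed.

Lemma cell_steps l m n p c : cell l m n p c ->
  [/\ step l m, step l n, step m p & step n p].
Proof.
case=> [pl -> -> | j {}p -> -> h | b -> h | a h -> | a b {}p ab h1 h2 h3 h4
      | i j j' {}p h1 -> h2]; split; eauto using cov_step; apply: step_refl => //.
- by case: h.
- by case: h.
- by case: h.
- by case: h.
- by case: h.
- by case: h.
Qed.

(** Two neighbouring lines that differ in one place differ everywhere to its right: no kind of cell
    closes the gap. *)
Lemma cell_cov l m n p c a : cell l m n p c -> cov l a m -> exists b, cov n b p.
Proof.
case=> [pl Em _ | j {}p Em _ h | b Em h | a' h -> | a' b {}p ab h1 h2 h3 h4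
      | i j j' {}p h1 -> h2] ha; try by move: (cov_neq ha); rewrite Em eqxx.
- by exists a'.
- by exists a'.
- by exists (i.+1, j').
Qed.

Lemma cov_box_inj l a b m : cov l a m -> cov l b m -> a = b.
Proof.
move=> [_ _ n1 e1] [_ _ n2 e2].
by have := e1 a; rewrite e2 eqxx (negPf n1) orbT => /eqP.
Qed.

(** With [l], [n] the shapes of a tableau before and after its largest entry and [m], [p] those
    after an insertion, [b] is the box of that entry: it is pushed into the next row if the
    insertion ends there, and stays put otherwise. *)
Lemma cell_both l m n p c a b : cell l m n p c -> cov l a m -> cov l b n ->
  if a == b then m = n /\ exists j, cov m (a.1.+1, j) p else cov m b p /\ cov n a p.
Proof.
case=> [pl Em _ | j {}p Em _ h | b' Em h | a' h Em | a' b' {}p ab h1 h2 h3 h4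
      | i j j' {}p h1 Em h2] ha hb; try by move: (cov_neq ha); rewrite Em eqxx.
- by move: (cov_neq hb); rewrite Em eqxx.
- by rewrite (cov_box_inj ha h1) (cov_box_inj hb h2) (negPf ab).
- rewrite Em in hb *; rewrite (cov_box_inj ha h1) (cov_box_inj hb h1) eqxx.
  by split=> //; exists j'.
Qed.

(** * Chains of labels and growth across one strip *)

Definition chain (f : nat -> part) : Prop := f 0 = [::] /\ forall k, step (f k) (f k.+1).

Lemma chain_part f k : chain f -> is_part (f k).
Proof. by case=> _ /(_ k)[]. Qed.

(** The line of labels directly above the line [f], with crosses in the columns satisfying [c] and
    the empty partition on the left border. *)
Fixpoint grow (c : pred nat) (f : nat -> part) (k : nat) : part :=
  if k is k'.+1 then fwd (f k') (grow c f k') (f k) (c k) else [::].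

Lemma eq_grow c d f g n : (forall k, k <= n -> c k = d k) -> (forall k, k <= n -> f k = g k) ->
  forall k, k <= n -> grow c f k = grow d g k.
Proof.
by move=> cd fg; elim=> //= k IH kn; rewrite IH ?fg ?cd //; lia.
Qed.

Lemma grow_stay c f n : chain f -> (forall k, k <= n -> c k = false) ->
  forall k, k <= n -> grow c f k = f k.
Proof.
move=> [f0 fS] c0; elim=> [//|k IH] kn /=; rewrite IH ?c0; try lia.
apply: fwdE; have [pk [->|[b h]]] := fS k; first exact: cell_id.
exact: cell_right h.
Qed.

(** The equation [f x = f x.-1] says that [x] is not an entry of the tableau of [f]. The lines agree
    left of the cross at [x], and from there on [cell_cov] keeps them one box apart. *)
Lemma grow_cov x f k : chain f -> 0 < x -> f x = f x.-1 -> x <= k ->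
  exists b, cov (f k) b (grow (pred1 x) f k).
Proof.
move=> cf x0 fx; case: x x0 fx => // x _ /= fx; have [f0 fS] := cf.
elim: k => // k IH; rewrite leq_eqVlt ltnS => /orP[/eqP[E]|lt_x].
  rewrite /= -E fx.
  rewrite (grow_stay (n := x) cf) //; last by move=> k' /=; lia.
  have pl := chain_part x cf.
  have := @fwd_cell (f x) (f x) (f x) true (step_refl pl) (step_refl pl).
  by rewrite eqxx => h; have {}h := h (fun _ => ltac:(split; reflexivity)); inversion h; eauto.
have [b hb] := IH lt_x; rewrite /= (_ : (k.+1 == x.+1) = false); last by lia.
have := @fwd_cell (f k) (grow (pred1 x.+1) f k) (f k.+1) false (cov_step hb) (fS k).
by move=> h; apply: cell_cov (h ltac:(done)) hb.
Qed.

Lemma grow_cell x f k : chain f -> 0 < x -> f x = f x.-1 ->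
  cell (f k) (grow (pred1 x) f k) (f k.+1) (grow (pred1 x) f k.+1) (k.+1 == x).
Proof.
move=> cf x0 fx; have [f0 fS] := cf; apply: fwd_cell => //.
  case: (leqP x k) => h; first by have [b hb] := grow_cov cf x0 fx h; eauto.
  rewrite (grow_stay (n := k) cf) //; last by move=> k' /=; lia.
  exact/step_refl/chain_part.
move=> /eqP E; subst x; split=> //.
by rewrite (grow_stay (n := k) cf) // => k' /=; lia.
Qed.

Lemma grow_chain x f : chain f -> 0 < x -> f x = f x.-1 -> chain (grow (pred1 x) f).
Proof.
by move=> cf x0 fx; split=> // k; case: (cell_steps (grow_cell k cf x0 fx)).
Qed.

(** * Tableaux of chains of partitions *)

Fixpoint tabn (f : nat -> part) (n : nat) : tab :=
  if n is n'.+1 then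
    if f n != f n' then tab_add (tabn f n') (diffrow (f n') (f n)) n else tabn f n'
  else [::].

Fixpoint newrow (x : nat) (T : tab) : nat :=
  if T is row :: rest then
    if has (fun a => x < a) row then (newrow (nth 0 [seq a <- row | x < a] 0) rest).+1 else 0
  else 0.

Definition below (M : nat) (T : tab) := all (all (fun a => a < M)) T.

Lemma eq_tabn f g n : (forall k, k <= n -> f k = g k) -> tabn f n = tabn g n.
Proof.
elim: n => //= n IH fg; rewrite !fg // IH // => k kn; apply: fg; lia.
Qed.

Lemma shape_rowins x T : map size (rowins x T) = incr_nth (map size T) (newrow x T).
Proof.
elim: T x => //= row T IH x; case: ifP => _ /=; last by rewrite size_rcons.
by rewrite size_map IH.
Qed.

Lemma tab_addS row T i M : tab_add (row :: T) i.+1 M = row :: tab_add T i M.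
Proof. by rewrite /tab_add /= ltnS; case: ifP. Qed.

Lemma shape_tab_add T i M : i <= size T ->
  map size (tab_add T i M) = incr_nth (map size T) i.
Proof.
elim: T i => [|row T IH] [|i] //= iT; last by rewrite tab_addS /= IH.
by rewrite /tab_add /= size_rcons.
Qed.

Lemma perm_tab_add T i M : i <= size T ->
  perm_eq (flatten (tab_add T i M)) (M :: flatten T).
Proof.
elim: T i => [|row T IH] [|i] //= iT.
  by apply/permP=> p; rewrite /tab_add /= -cats1 -catA !count_cat /=; lia.
rewrite tab_addS /=; apply/permP=> p; move/permP/(_ p): (IH i iT) => /= e.
by rewrite !count_cat e; lia.
Qed.

Lemma rowins_max M T : below M T -> rowins M T = tab_add T 0 M.
Proof.
case: T => //= row T /andP[hr _]; rewrite ifF //; apply/hasPn => a /(allP hr); lia.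
Qed.

Lemma nth_filter_has (P : pred nat) s : has P s ->
  0 < size [seq a <- s | P a] /\ nth 0 [seq a <- s | P a] 0 \in s.
Proof.
rewrite has_count -size_filter => h; split=> //.
by have := mem_nth 0 h; rewrite mem_filter => /andP[].
Qed.

(** The entry [M] is larger than all others and so bumps nothing; it stands at the end of row [i]
    and is itself bumped exactly when the path would otherwise have ended in that row. *)
Lemma rowins_tab_add x T i M : below M T -> x < M -> i <= size T ->
  rowins x (tab_add T i M) = tab_add (rowins x T) (i + (i == newrow x T)) M.
Proof.
elim: T i x => [|row T IH] i x /=.
  by case: i => // _ xM _; rewrite /tab_add /= xM eqxx.
case/andP=> hr hT xM iT; have h := allP hr.
case: i iT => [|i] iT.
  rewrite /tab_add /= has_rcons xM /= filter_rcons xM map_rcons.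
  case: (boolP (has (fun a => x < a) row)) => hx /=.
    have [s0 zr] := nth_filter_has hx.
    rewrite nth_rcons s0 (_ : (M == _) = false) //; have := h _ zr; lia.
  have -> /= : [seq a <- row | x < a] = [::].
    by apply/eqP; rewrite -size_eq0 size_filter -leqn0 leqNgt -has_count.
  rewrite eqxx rowins_max // /tab_add /= ltnS.
  have -> : [seq (if a == M then x else a) | a <- row] = row.
    by apply: map_id_in => a /h; case: eqP => // ->; rewrite ltnn.
  by case: ifP.
rewrite tab_addS /=; case: ifP => hx /=; last by rewrite addn0 tab_addS.
have [_ zr] := nth_filter_has hx.
by rewrite IH // ?h // eqSS addSn tab_addS.
Qed.

Lemma incr_nth_inj l : injective (incr_nth l).
Proof.
move=> i j /(congr1 (nth 0 ^~ i)); rewrite !nth_incr_nth eqxx.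
by case: eqP => //; lia.
Qed.

Lemma tabn_shape f n : chain f -> map size (tabn f n) = f n.
Proof.
move=> cf; have [f0 fS] := cf; elim: n => [|n IH] /=; first by rewrite f0.
have [_ [->|[b hb]]] := fS n; first by rewrite eqxx.
rewrite eq_sym (cov_neq hb) /= (cov_diffrow hb).1.
case: b hb => i j hb /=; rewrite shape_tab_add ?IH -?(cov_incr hb) //.
by rewrite -(size_map size) IH (cov_size_le hb).
Qed.

Lemma tabn_cov f n b : chain f -> cov (f n) b (f n.+1) ->
  tabn f n.+1 = tab_add (tabn f n) b.1 n.+1 /\ b.1 <= size (tabn f n).
Proof.
case: b => i j cf hb; split; last by rewrite -(size_map size) tabn_shape // (cov_size_le hb).
by rewrite /= eq_sym (cov_neq hb) /= (cov_diffrow hb).1.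
Qed.

Lemma perm_tabn f n : chain f ->
  perm_eq (flatten (tabn f n)) [seq k <- iota 1 n | f k != f k.-1].
Proof.
move=> cf; have [f0 fS] := cf; elim: n => [|n IH] //.
have -> : iota 1 n.+1 = iota 1 n ++ [:: n.+1] by rewrite -(iotaD 1 n 1) addn1.
rewrite filter_cat [filter _ [:: _]]/=.
have [_ [E|[b hb]]] := fS n; first by rewrite /= E eqxx cats0.
have [-> bT] := tabn_cov cf hb; rewrite (eq_sym (f n.+1)) (cov_neq hb).
apply: perm_trans (perm_tab_add _ bT) _; rewrite perm_sym perm_catC /= perm_cons.
by rewrite perm_sym.
Qed.

Lemma mem_tabn f n a : chain f ->
  (a \in flatten (tabn f n)) = (0 < a <= n) && (f a != f a.-1).
Proof.
by move=> cf; rewrite (perm_mem (perm_tabn n cf)) mem_filter mem_iota andbC add1n ltnS.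
Qed.

Lemma uniq_tabn f n : chain f -> uniq (flatten (tabn f n)).
Proof. by move=> cf; rewrite (perm_uniq (perm_tabn n cf)) filter_uniq ?iota_uniq. Qed.

Lemma below_tabn f n : chain f -> below n.+1 (tabn f n).
Proof.
move=> cf; apply/allP=> row rT; apply/allP=> a ar.
have : a \in flatten (tabn f n) by apply/flattenP; exists row.
by rewrite mem_tabn //; lia.
Qed.

(** Induction on [n]: the cell in column [n.+1] prescribes for the entry [n.+1] exactly the move
    found in [rowins_tab_add]. *)
Lemma rowins_tabn x f n : chain f -> 0 < x <= n -> f x = f x.-1 ->
  rowins x (tabn f n) = tabn (grow (pred1 x) f) n.
Proof.
move=> cf /andP[x0 xn] fx; elim: n xn => [|n IH]; first by lia.
have cg := grow_chain cf x0 fx.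
have hc := grow_cell n cf x0 fx.
rewrite leq_eqVlt => /orP[/eqP E|]; last rewrite ltnS => xn.
  (* Here [x] is larger than all entries present and goes to the end of the first row, which is F3
     with a cross. *)
  subst x; have {}fx : f n.+1 = f n by []; rewrite eqxx in hc.
  have -> : tabn f n.+1 = tabn f n by rewrite /= fx eqxx.
  have gk k : k <= n -> grow (pred1 n.+1) f k = f k.
    by apply: grow_stay => // k' k'n /=; lia.
  have hb : exists j, cov (f n) (0, j) (grow (pred1 n.+1) f n.+1).
    by inversion hc; eauto.
  have [j hj] := hb; rewrite -(gk n) // in hj.
  have [e _] := tabn_cov cg hj; rewrite e rowins_max ?below_tabn //.
  by congr tab_add; apply: eq_tabn => k kn; rewrite gk.
rewrite (_ : (n.+1 == x) = false) in hc; last by lia.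
have [a ha] := grow_cov cf x0 fx xn.
have hn : newrow x (tabn f n) = a.1.
  case: a ha => i j ha; apply: (@incr_nth_inj (f n)).
  by rewrite -{1}(tabn_shape n cf) -shape_rowins IH // tabn_shape // (cov_incr ha).
have [_ [E|[d hd]]] := (cf.2 n).
  have E' : grow (pred1 x) f n.+1 = grow (pred1 x) f n.
    rewrite /= E; have -> : (n.+1 == x) = false by lia.
    by apply: fwdE; apply: cell_up ha _.
  by rewrite /= -/(grow (pred1 x) f n.+1) E E' !eqxx /= IH.
have [-> dT] := tabn_cov cf hd.
rewrite rowins_tab_add ?below_tabn //.
rewrite IH // hn; have := cell_both hc ha hd.
case: (eqVneq a d) => [<- [_ [j hp]]|ad [hp _]].
  by have [-> _] := tabn_cov cg hp; rewrite eqxx addn1.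
have [-> _] := tabn_cov cg hp; rewrite (_ : (d.1 == a.1) = false) ?addn0 //.
apply/eqP=> E; case/eqP: ad; case: a d ha hd E {hn hp dT} => [i j] [i' j'] /= ha hd E.
by rewrite E in hd *; rewrite (cov_box ha hd).
Qed.

(** * Transposition and column insertion *)

Lemma leq_foldr_maxn s a : a \in s -> a <= foldr maxn 0 s.
Proof. by elim: s => //= b s IH; rewrite inE => /orP[/eqP->|/IH]; lia. Qed.

Definition tcol (T : tab) (j : nat) : seq nat := [seq nth 0 row j | row <- T & j < size row].

Lemma tcol_cons row T j :
  tcol (row :: T) j = if j < size row then nth 0 row j :: tcol T j else tcol T j.
Proof. by rewrite /tcol /=; case: ifP. Qed.

Lemma tcol_nil T j : all (fun row => size row <= j) T -> tcol T j = [::].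
Proof. by elim: T => //= row T IH /andP[h /IH]; rewrite /tcol /= ltnNge h. Qed.

Lemma nth_trans T j : nth [::] (trans T) j = tcol T j.
Proof.
case: (ltnP j (foldr maxn 0 (map size T))) => h; first by rewrite nth_mkseq.
rewrite nth_default ?size_mkseq // tcol_nil //; apply/allP=> row rT.
exact: leq_trans (leq_foldr_maxn (map_f size rT)) h.
Qed.

Lemma foldr_maxn_part l : is_part l -> foldr maxn 0 l = nth 0 l 0.
Proof.
elim: l => //= a l IH /andP[/= s /andP[_ p]].
have pl : is_part l by rewrite /is_part (path_sorted s) p.
by rewrite IH //; case: l s {IH p pl} => //= b l /andP[]; lia.
Qed.

Lemma tcol_tab_add T i M k : is_part (map size T) -> i <= size T ->
  tcol (tab_add T i M) k =
  if k == nth 0 (map size T) i then rcons (tcol T k) M else tcol T k.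
Proof.
elim: T i => [|row T IH] i pT.
  by case: i => // _; rewrite /tcol /tab_add /=; case: k.
have pT' : is_part (map size T).
  by case/andP: pT => /= /path_sorted s /andP[_ p]; apply/andP.
case: i => [_|i]; last first.
  by rewrite tab_addS !tcol_cons => iT; rewrite IH //=; do 2!case: ifP.
(* Lower rows are no longer than the first one, so a column beyond its end is empty and a new entry
   there is alone in it. *)
have hn : size row <= k -> tcol T k = [::].
  move=> rk; apply: tcol_nil; apply/allP=> r0 r0T.
  have : index r0 T < size T by rewrite index_mem.
  move=> lt; have := @leq_nth_part (map size (row :: T)) 0 (index r0 T).+1 pT isT.
  by rewrite /= (nth_map [::]) // nth_index //; lia.
rewrite /tab_add /= !tcol_cons size_rcons ltnS.
case: (ltngtP k (size row)) => kr /=.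
- by rewrite nth_rcons kr.
- by [].
- by rewrite nth_rcons hn kr ?ltnn ?eqxx.
Qed.

Lemma trans_tab_add T i j M m : cov (map size T) (i, j) m ->
  trans (tab_add T i M) = tab_add (trans T) j M.
Proof.
move=> h; have [pT pm _ _] := h; have [e1 e2] := cov_nth h.
have iT : i <= size T by have := cov_size_le h; rewrite size_map.
have sT : size (trans T) = nth 0 (map size T) 0 by rewrite size_mkseq foldr_maxn_part.
have sA : size (trans (tab_add T i M)) = nth 0 m 0.
  by rewrite size_mkseq shape_tab_add // -(cov_incr h) foldr_maxn_part.
(* The new box opens a new column exactly when it lies in the first row; this selects the branch of
   [tab_add] for the transposed tableau. *)
have jT : (j < size (trans T)) = (0 < i).
  rewrite sT -e1; case: i h e1 e2 iT {sA} => [|i] h e1 e2 iT; first by rewrite ltnn.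
  have := leq_nth_part pm (leqnSn i); have := leq_nth_part pT (leq0n i).
  by rewrite !e2 eqxx (_ : (i == i.+1) = false); lia.
apply: (@eq_from_nth _ [::]).
  rewrite sA e2 /tab_add jT; case: (posnP i) => [->|i0].
    by rewrite size_rcons sT addn1.
  rewrite size_set_nth sT; move: jT; rewrite sT i0; lia.
move=> k _; rewrite nth_trans tcol_tab_add // e1 /tab_add jT.
case: (posnP i) => [i0|i0].
  have -> : j = size (trans T) by rewrite sT -e1 i0.
  rewrite nth_rcons -nth_trans; case: (ltngtP k (size (trans T))) => hk //.
  - by rewrite nth_default // ltnW.
  - by rewrite nth_default ?hk.
by rewrite nth_set_nth /= !nth_trans; case: eqP => [->|].
Qed.

Lemma conj_chain f : chain f -> chain (fun k => conj (f k)).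
Proof.
move=> [f0 fS]; split=> [|k]; first by rewrite f0.
have [pk h] := fS k; split; first exact: conj_part.
case: h => [->|[[i j] h]]; [by left | right; exists (j, i); exact: cov_conj].
Qed.

Lemma trans_tabn f n : chain f -> trans (tabn f n) = tabn (fun k => conj (f k)) n.
Proof.
move=> cf; have cc := conj_chain cf; elim: n => // n IH.
have [_ [E|[[i j] h]]] := cf.2 n; first by rewrite /= E !eqxx.
have [-> _] := tabn_cov cf h; have [-> _] := tabn_cov cc (cov_conj h).
by rewrite -IH /=; apply: (@trans_tab_add _ _ _ _ (f n.+1)); rewrite tabn_shape.
Qed.

Definition cgrow (x : nat) (f : nat -> part) (k : nat) : part :=
  conj (grow (pred1 x) (fun k => conj (f k)) k).

Lemma cgrow_chain x f : chain f -> 0 < x -> f x = f x.-1 -> chain (cgrow x f).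
Proof.
move=> cf x0 fx; apply/conj_chain/grow_chain => //; first exact: conj_chain.
by rewrite fx.
Qed.

Lemma colins_tabn x f n : chain f -> 0 < x <= n -> f x = f x.-1 ->
  colins x (tabn f n) = tabn (cgrow x f) n.
Proof.
move=> cf xn fx; have cc := conj_chain cf.
rewrite /colins trans_tabn // rowins_tabn ?fx // trans_tabn //.
by apply: grow_chain; rewrite ?fx //; case/andP: xn.
Qed.

(** * Commutation of row and column insertion *)

Lemma cov_conjK l m i j : is_part l -> is_part m ->
  cov (conj l) (j, i) (conj m) -> cov l (i, j) m.
Proof. by move=> pl pm /cov_conj; rewrite !conjK. Qed.

Lemma conj_inj l m : is_part l -> is_part m -> conj l = conj m -> l = m.
Proof. by move=> pl pm /(congr1 conj); rewrite !conjK. Qed.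

Lemma cov_boxc l i i' j l1 l2 : cov l (i, j) l1 -> cov l (i', j) l2 -> i = i'.
Proof. by move=> /cov_conj h1 /cov_conj; apply: cov_box h1. Qed.

(** A cell for column insertion. The partition conditions allow [conj] to be cancelled, so that
    facts on [cell] carry over. *)
Definition ccell (l m n p : part) (c : bool) : Prop :=
  [/\ is_part l, is_part m, is_part n, is_part p
    & cell (conj l) (conj m) (conj n) (conj p) c].

Lemma cell_fun l m n p p' c : cell l m n p c -> cell l m n p' c -> p = p'.
Proof. by move=> /fwdE <- /fwdE <-. Qed.

Lemma cell_flat l n p : cell l l n p false -> p = n.
Proof.
move=> h; have [_ [pl [E|[b hb]]] _ _] := cell_steps h.
  by apply: cell_fun h _; rewrite E; apply: cell_id.
by apply: cell_fun h _; apply: cell_right hb.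
Qed.

Lemma cell_cross_inv l m n p : cell l m n p true ->
  [/\ m = l, n = l & exists j, cov l (0, j) p].
Proof. by move=> h; inversion h; split=> //; exists j. Qed.

Lemma cell_vert l a m p c : cov l a m -> cell l m l p c -> p = m /\ c = false.
Proof.
move=> ha; case: c => [/cell_cross_inv[E]|h]; first by move: (cov_neq ha); rewrite E eqxx.
by split=> //; apply: cell_fun h _; apply: cell_up ha _.
Qed.

Lemma ccell_fun l m n p p' c : ccell l m n p c -> ccell l m n p' c -> p = p'.
Proof. by move=> [_ _ _ p1 h1] [_ _ _ p2 h2]; apply: conj_inj => //; apply: cell_fun h1 h2. Qed.

Lemma ccell_flat l n p : ccell l l n p false -> p = n.
Proof. by move=> [_ _ p1 p2 /cell_flat]; apply: conj_inj. Qed.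

Lemma ccell_cross_inv l m n p : ccell l m n p true ->
  [/\ m = l, n = l & exists j, cov l (j, 0) p].
Proof.
move=> [p1 p2 p3 p4 /cell_cross_inv[/conj_inj-> // /conj_inj-> // [j hj]]].
by split=> //; exists j; apply: cov_conjK.
Qed.

Lemma ccell_vert l a m p c : cov l a m -> ccell l m l p c -> p = m /\ c = false.
Proof.
case: a => i j /cov_conj ha [p1 p2 p3 p4 h].
by have [/conj_inj-> //] := cell_vert ha h.
Qed.

Lemma ccell_both l m n p c a b : ccell l m n p c -> cov l a m -> cov l b n ->
  if a == b then m = n /\ exists i, cov m (i, a.2.+1) p else cov m b p /\ cov n a p.
Proof.
case: a b => [i j] [i' j'] [p1 p2 p3 p4 h] /cov_conj ha /cov_conj hb.
have := cell_both h ha hb; rewrite !xpair_eqE andbC; case: ifP => _.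
  by move=> [/conj_inj-> // [k hk]]; split=> //; exists k; apply: cov_conjK.
by move=> [h1 h2]; split; apply: cov_conjK.
Qed.

Definition adj (u w : nat * nat) : Prop := w = (u.1, u.2.+1) \/ w = (u.1.+1, u.2).

(** A partition containing [w] also contains [u], so [w] cannot be the single box added to a shape
    without [u]. *)
Lemma adj_not_cov l u w m n : adj u w -> cov l u m -> ~ cov l w n.
Proof.
case: u => i j uw [_ _ n1 _] [pl pn n2 e].
have hw : inp n w by rewrite e eqxx orbT.
have : inp n (i, j).
  by case: uw hw => -> /= hw; apply: (inp_le pn hw).
rewrite e (negPf n1) /= => /eqP E; case: uw; rewrite -E => -[]; lia.
Qed.

(* [l], [a], [b], [g] are the shapes of the entries at most [k] of a tableau and of its
   images under a row insertion, a column insertion, and both. *)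
Inductive cube (l a b g : part) : Prop :=
  | cube_none of is_part l & a = l & b = l & g = l
  | cube_row u of cov l u a & b = l & g = a
  | cube_col v of a = l & cov l v b & g = b
  | cube_join u v of u != v & cov l u a & cov l v b & cov a v g & cov b u g
  | cube_adj u w of cov l u a & b = a & cov a w g & adj u w.

(** The four cells are the side faces between the cubes at [k] and [k.+1]: the row insertion acts on
    the tableau and on its column-inserted image, and vice versa. The cases are the kind of cube,
    the crosses and the box [d] of the entry [k.+1]; in each, comparing the rows or columns of the
    boxes forces [g1 = g2]. *)
Lemma cube_step l a b g l' a' b' g1 g2 cx cy :
  cube l a b g -> ~~ (cx && cy) ->
  cell l a l' a' cy -> ccell l b l' b' cx ->
  cell b g b' g1 cy -> ccell a g a' g2 cx ->
  g1 = g2 /\ cube l' a' b' g1.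
Proof.
move=> hq cxy h1 h2 h3 h4; have [_ [pl hl] _ _] := cell_steps h1.
have pl' : is_part l' by have [_ /step_part] := cell_steps h1.
case: hq => [_ Ea Eb Eg|u hu Eb Eg|v Ea hv Eg|u v uv hua hvb hvg hug|u w hu Eb hw uw]; subst.
- case: cy cxy h1 h3 => [cxy|_] h1 h3.
    case: cx cxy h2 h4 => // _ h2 h4.
    have [_ ? [j hj]] := cell_cross_inv h1; subst l'.
    have ? := ccell_flat h2; have ? := ccell_flat h4; subst b' g2.
    have [_ _ [j' hj']] := cell_cross_inv h3.
    have ? := cov_box hj hj'; subst j'; have -> := cov_fun hj' hj; split=> //.
    by apply: cube_row hj _ _.
  have ? := cell_flat h1; subst a'.
  case: cx h2 h4 => h2 h4.
    have [_ ? [j hj]] := ccell_cross_inv h2; subst l'.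
    have ? := cell_flat h3; subst g1.
    have [_ _ [j' hj']] := ccell_cross_inv h4.
    have ? := cov_boxc hj hj'; subst j'; have -> := cov_fun hj' hj; split=> //.
    by apply: cube_col _ hj _.
  have ? := ccell_flat h2; have ? := ccell_flat h4; subst b' g2.
  by have ? := cell_flat h3; subst g1; split=> //; apply: cube_none.
- case: cy cxy h1 h3 => [cxy|_] h1 h3.
    by have [E] := cell_cross_inv h1; move: (cov_neq hu); rewrite E eqxx.
  case: cx h2 h4 => h2 h4; last first.
    have ? := ccell_flat h2; have ? := ccell_flat h4; subst b' g2.
    have ? := cell_fun h1 h3; subst g1; split=> //.
    by have [b hb] := cell_cov h1 hu; apply: cube_row hb _ _.
  have [_ ? [j hj]] := ccell_cross_inv h2; subst l'.
  have [? _] := cell_vert hu h1; subst a'.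
  have [_ _ [j' hj']] := ccell_cross_inv h4.
  (* The new column-inserted entry goes to the foot of the first column; if [u] is that box, it is
     pushed directly below. *)
  have := cell_both h3 hu hj; case: (eqVneq u (j, 0)) => [E [? [k hk]]|uv [k1 k2]].
    subst u b'; have [_ e] := cov_nth (cov_conj hu); have [e1 _] := cov_nth (cov_conj hj').
    have [e2 _] := cov_nth (cov_conj hu).
    have Ej : j' = j.+1 by rewrite -e1 e e2 eqxx addn1.
    rewrite Ej in hj'; rewrite /= in hk; have ? := cov_box hk hj'; subst k.
    have -> := cov_fun hk hj'; split=> //.
    by apply: (cube_adj hu _ hj') => //; right.
  have ? := cov_boxc k1 hj'; subst j'.
  have -> := cov_fun hj' k1; split=> //.
  exact: (cube_join uv).
- case: cx cxy h2 h4 => [cxy|_] h2 h4.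
    by have [E] := ccell_cross_inv h2; move: (cov_neq hv); rewrite E eqxx.
  case: cy h1 h3 => h1 h3; last first.
    have ? := cell_flat h1; have ? := cell_flat h3; subst a' g1.
    have ? := ccell_fun h2 h4; subst g2; split=> //.
    case: v hv => i j hv; have [p1 p2 p3 p4 h2'] := h2.
    have [[i' j'] hb] := cell_cov h2' (cov_conj hv).
    by apply: (@cube_col _ _ _ _ (j', i')) => //; apply: cov_conjK.
  have [_ ? [j hj]] := cell_cross_inv h1; subst l'.
  have [? _] := ccell_vert hv h2; subst b'.
  have [_ _ [j' hj']] := cell_cross_inv h3.
  have := ccell_both h4 hv hj; case: (eqVneq v (0, j)) => [E [? [k hk]]|uv [k1 k2]].
    subst v a'; have [_ e] := cov_nth hv; have [e1 _] := cov_nth hj'.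
    have [e2 _] := cov_nth hv.
    have Ej : j' = j.+1 by rewrite -e1 e e2 eqxx addn1.
    rewrite Ej in hj'; rewrite /= in hk; have ? := cov_boxc hk hj'; subst k.
    have -> := cov_fun hk hj'; split=> //.
    by apply: (cube_adj hv _ hj') => //; left.
  have ? := cov_box k1 hj'; subst j'.
  have -> := cov_fun hj' k1; split=> //.
  by rewrite eq_sym in uv; apply: (cube_join uv).
- case: hl => [?|[d hd]].
    subst l'; have [? _] := cell_vert hua h1; have [? _] := ccell_vert hvb h2; subst a' b'.
    have [? _] := cell_vert hug h3; have [? _] := ccell_vert hvg h4; subst g1 g2.
    by split=> //; apply: (cube_join uv).
  have := cell_both h1 hua hd; have := ccell_both h2 hvb hd.
  (* The entry [k.+1] sits in [d]. If [d = v], the column insertion moves it one column on, where it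
     may meet [u] and be moved once more by the row insertion; the new cube is then of the adjacent
     kind. The case [d = u] is symmetric. *)
  case: (eqVneq v d) => [?|vd].
    subst d; move=> [? [i hi]]; subst l'; rewrite (negPf uv) => -[k1 k2].
    have := ccell_both h4 hvg k1; rewrite eqxx => -[? [i2 hi2]]; subst a'.
    have := cell_both h3 hug hi; case: (eqVneq u (i, v.2.+1)) => [?|ue].
      subst u; move=> [? [j hj]]; subst b'.
      have [j0 j1] := cov_nth (cov_conj hi); have [j2 _] := cov_nth (cov_conj hi2).
      rewrite j1 j0 eqxx addn1 in j2; subst i2.
      rewrite /= in hj; have ? := cov_box hi2 hj; subst j.
      have -> := cov_fun hj hi2; split=> //.
      by apply: (cube_adj k2 _ hi2) => //; right.
    move=> [m1 m2]; have ? := cov_boxc m1 hi2; subst i2.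
    have E := cov_fun hi2 m1; rewrite E in hi2 *; split=> //.
    exact: (cube_join ue).
  move=> [k1 k2]; case: (eqVneq u d) => [?|ud].
    subst d; move=> [? [i hi]]; subst l'.
    have := cell_both h3 hug k1; rewrite eqxx => -[? [i2 hi2]]; subst b'.
    have := ccell_both h4 hvg hi; case: (eqVneq v (u.1.+1, i)) => [?|ue].
      subst v; move=> [? [j hj]]; subst a'.
      have [j0 j1] := cov_nth hi; have [j2 _] := cov_nth hi2.
      rewrite j1 j0 eqxx addn1 in j2; subst i2.
      rewrite /= in hj; have ? := cov_boxc hi2 hj; subst j.
      have -> := cov_fun hj hi2; split=> //.
      by apply: (cube_adj k2 _ hi2) => //; left.
    move=> [m1 m2]; have ? := cov_box m1 hi2; subst i2.
    have E := cov_fun hi2 m1; rewrite E in hi2 *; split=> //.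
    by rewrite eq_sym in ue; apply: (cube_join ue).
  move=> [m1 m2].
  have := cell_both h3 hug k1; rewrite (negPf ud) => -[n1 n2].
  have := ccell_both h4 hvg m1; rewrite (negPf vd) => -[n3 n4].
  have E := cov_fun n3 n1; rewrite E in n3 n4 *; split=> //.
  exact: (cube_join uv).
- case: hl => [?|[d hd]].
    subst l'; have [? _] := cell_vert hu h1; have [? _] := ccell_vert hu h2; subst a' b'.
    have [? _] := cell_vert hw h3; have [? _] := ccell_vert hw h4; subst g1 g2.
    by split=> //; apply: (cube_adj hu _ hw).
  have := cell_both h1 hu hd; have := ccell_both h2 hu hd.
  case: (eqVneq u d) => [?|ud].
    subst d; move=> [? [i hi]] [_ [j hj]]; subst l'.
    (* The box [w] is where one insertion moves the entry [k.+1]: the column insertion if [w] is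
       right of [u], the row insertion if it is below. The boxes of the new cube are distinct. *)
    case: uw => ?; subst w.
      have ? := cov_boxc hw hi; subst i; have ? := cov_fun hw hi; subst b'.
      have := cell_both h3 hw hw; rewrite eqxx => -[_ [k hk]]; rewrite /= in hk.
      have := ccell_both h4 hw hj.
      have ne : (u.1.+1, j) != (u.1, u.2.+1) by rewrite xpair_eqE; lia.
      rewrite eq_sym (negPf ne) => -[m1 m2].
      have ? := cov_box m1 hk; subst k.
      have E := cov_fun hk m1; rewrite E in hk *; split=> //.
      exact: (cube_join ne).
    have ? := cov_box hw hj; subst j; have ? := cov_fun hw hj; subst a'.
    have := ccell_both h4 hw hw; rewrite eqxx => -[_ [k hk]]; rewrite /= in hk.
    have := cell_both h3 hw hi.
    have ne : (u.1.+1, u.2) != (i, u.2.+1) by rewrite xpair_eqE; lia.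
    rewrite (negPf ne) => -[m1 m2].
    have ? := cov_boxc m1 hk; subst k.
    have E := cov_fun hk m1; rewrite E in hk *; split=> //.
    exact: (cube_join ne).
  move=> [k1 k2] [m1 m2]; have ? := cov_fun k1 m1; subst b'.
  have wd : (w == d) = false.
    by apply/eqP=> ?; subst d; exact: adj_not_cov uw hu hd.
  have := cell_both h3 hw m1; have := ccell_both h4 hw m1; rewrite wd => -[n1 n2] [n3 n4].
  have E := cov_fun n1 n3; rewrite E; split=> //.
  exact: (cube_adj m2 _ n4).
Qed.

Lemma grow_at x y f : chain f -> 0 < x -> f x = f x.-1 -> x != y -> 0 < y ->
  f y = f y.-1 -> grow (pred1 x) f y = grow (pred1 x) f y.-1.
Proof.
move=> cf x0 fx xy; case: y xy => // y xy _; rewrite -pred_Sn => fy.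
have := grow_cell y cf x0 fx; rewrite eq_sym (negPf xy) fy.
case: (leqP x y) => h.
  by have [b hb] := grow_cov cf x0 fx h => /(cell_vert hb)[].
have E : grow (pred1 x) f y = f y by apply: (grow_stay (n := y)) => // k ky /=; lia.
by rewrite E => /cell_flat ->.
Qed.

Lemma cgrow_at x y f : chain f -> 0 < x -> f x = f x.-1 -> x != y -> 0 < y ->
  f y = f y.-1 -> cgrow x f y = cgrow x f y.-1.
Proof.
move=> cf x0 fx xy y0 fy; rewrite /cgrow grow_at //; first exact: conj_chain.
  by rewrite fx.
by rewrite fy.
Qed.

Lemma cgrow_ccell x f k : chain f -> 0 < x -> f x = f x.-1 ->
  ccell (f k) (cgrow x f k) (f k.+1) (cgrow x f k.+1) (k.+1 == x).
Proof.
move=> cf x0 fx; have cc := conj_chain cf; have cg := cgrow_chain cf x0 fx.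
split; try exact: chain_part.
have fx' : conj (f x) = conj (f x.-1) by rewrite fx.
have cgc := grow_chain cc x0 fx'.
rewrite /cgrow (conjK (chain_part k cgc)) (conjK (chain_part k.+1 cgc)).
exact: (grow_cell k cc x0 fx').
Qed.

(** The cubes for successive [k] start from four empty shapes, and [cube_step] carries the equality
    of the two orders along. *)
Lemma grow_cgrow x y f k : chain f -> 0 < x -> 0 < y -> x != y ->
  f x = f x.-1 -> f y = f y.-1 ->
  grow (pred1 y) (cgrow x f) k = cgrow x (grow (pred1 y) f) k.
Proof.
move=> cf x0 y0 xy fx fy.
have yx : y != x by rewrite eq_sym.
have cx := cgrow_chain cf x0 fx; have cy := grow_chain cf y0 fy.
have hx := cgrow_at cf x0 fx xy y0 fy; have hy := grow_at cf y0 fy yx x0 fx.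
suff [] : grow (pred1 y) (cgrow x f) k = cgrow x (grow (pred1 y) f) k /\
  cube (f k) (grow (pred1 y) f k) (cgrow x f k) (grow (pred1 y) (cgrow x f) k) by [].
elim: k => [|k [IH1 IH2]].
  by split=> //; apply: cube_none; rewrite ?cf.1.
apply: (cube_step IH2 (cx := k.+1 == x) (cy := k.+1 == y)).
- by apply/negP => /andP[/eqP E1 /eqP E2]; rewrite -E1 -E2 eqxx in xy.
- exact: grow_cell.
- exact: cgrow_ccell.
- exact: grow_cell.
- by rewrite IH1; apply: cgrow_ccell.
Qed.

(** * Words and reading words *)

(* [T] is a tableau with entries in [1, n], none of which is a letter of [w]. *)
Definition tab_avoid (n : nat) (T : tab) (w : seq nat) : Prop :=
  exists f, [/\ chain f, T = tabn f n & forall x, x \in w -> 0 < x <= n /\ f x = f x.-1].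

Definition rowfold (w : seq nat) (T : tab) : tab := foldl (fun T a => rowins a T) T w.
Definition colfold (w : seq nat) (T : tab) : tab := foldl (fun T a => colins a T) T w.

Lemma tab_avoid_sub n T w v : {subset v <= w} -> tab_avoid n T w -> tab_avoid n T v.
Proof. by move=> vw [f [cf -> fw]]; exists f; split=> // x /vw/fw. Qed.

Lemma tab_avoid_row n T x w : uniq (x :: w) -> tab_avoid n T (x :: w) ->
  tab_avoid n (rowins x T) w.
Proof.
case/andP=> xw _ [f [cf -> fw]]; have [xn fx] := fw x (mem_head _ _).
have x0 : 0 < x by case/andP: xn.
exists (grow (pred1 x) f); split; rewrite ?rowins_tabn //; first exact: grow_chain.
move=> y yw; have [yn fy] : 0 < y <= n /\ f y = f y.-1 by apply: fw; rewrite inE yw orbT.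
split=> //; apply: grow_at => //; last by case/andP: yn.
by apply: contraNneq xw => ->.
Qed.

Lemma tab_avoid_col n T x w : uniq (x :: w) -> tab_avoid n T (x :: w) ->
  tab_avoid n (colins x T) w.
Proof.
case/andP=> xw _ [f [cf -> fw]]; have [xn fx] := fw x (mem_head _ _).
have x0 : 0 < x by case/andP: xn.
exists (cgrow x f); split; rewrite ?colins_tabn //; first exact: cgrow_chain.
move=> y yw; have [yn fy] : 0 < y <= n /\ f y = f y.-1 by apply: fw; rewrite inE yw orbT.
split=> //; apply: cgrow_at => //; last by case/andP: yn.
by apply: contraNneq xw => ->.
Qed.

Lemma rowins_colins n T x y : x != y -> tab_avoid n T [:: x; y] ->
  rowins y (colins x T) = colins x (rowins y T).
Proof.
move=> xy [f [cf -> fw]]; have yx : y != x by rewrite eq_sym.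
have [xn fx] : 0 < x <= n /\ f x = f x.-1 by apply: fw; rewrite !inE eqxx.
have [yn fy] : 0 < y <= n /\ f y = f y.-1 by apply: fw; rewrite !inE eqxx orbT.
have [x0 _] := andP xn; have [y0 _] := andP yn.
rewrite colins_tabn // rowins_tabn //; [|exact: cgrow_chain | exact: cgrow_at].
rewrite rowins_tabn // colins_tabn //; [|exact: grow_chain | exact: grow_at].
by apply: eq_tabn => k _; apply: grow_cgrow.
Qed.

Lemma colins_rowfold n x w T : uniq (x :: w) -> tab_avoid n T (x :: w) ->
  colins x (rowfold w T) = rowfold w (colins x T).
Proof.
elim: w T => //= y w IH T; rewrite inE negb_or -andbA => /and4P[xy xw yw uw] hT.
have hT' : tab_avoid n (rowins y T) (x :: w).
  apply: tab_avoid_row; first by rewrite /= inE negb_or eq_sym xy yw xw.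
  by apply: tab_avoid_sub hT => z; rewrite !inE orbCA.
rewrite IH ?xw // (rowins_colins (n := n) xy) //.
by apply: tab_avoid_sub hT => z; rewrite !inE orbA => ->.
Qed.

Lemma tab_avoid_rowfold n T u w : uniq (u ++ w) -> tab_avoid n T (u ++ w) ->
  tab_avoid n (rowfold u T) w.
Proof.
elim: u T => //= x u IH T /[dup] h /andP[_ uw] hT; apply: IH => //.
exact: tab_avoid_row.
Qed.

Lemma colfold_rowfold n u w T : uniq (u ++ w) -> tab_avoid n T (u ++ w) ->
  colfold u (rowfold w T) = rowfold w (colfold u T).
Proof.
elim: u T => //= x u IH T /[dup] uxw /andP[xw uw] hT.
have sxw : {subset x :: w <= x :: u ++ w}.
  by move=> z; rewrite !inE mem_cat; case: eqP => //= _ ->; rewrite orbT.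
rewrite (colins_rowfold (n := n)); last exact: tab_avoid_sub hT.
  by rewrite IH //; apply: tab_avoid_col.
move: xw uw; rewrite mem_cat negb_or cat_uniq /= => /andP[_ ->].
by case/and3P.
Qed.

Lemma tab_avoid_nil n w : (forall x, x \in w -> 0 < x <= n) -> tab_avoid n [::] w.
Proof.
move=> hw; exists (fun=> [::]); split=> [||x /hw //].
- by split=> // k; split=> //; left.
- by elim: n {hw}.
Qed.

(** A single letter gives the same tableau by either insertion into the empty one; by commutation
    the first letter of [w], column-inserted last, may be inserted first. *)
Lemma colfold_rev n w : uniq w -> (forall x, x \in w -> 0 < x <= n) ->
  colfold (rev w) [::] = rowfold w [::].
Proof.
elim: w => //= x w IH /[dup] uxw /andP[xw uw] hw.
rewrite rev_cons /colfold foldl_rcons -/(colfold _ _) IH //; last first.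
  by move=> z zw; apply: hw; rewrite inE zw orbT.
by rewrite (colins_rowfold (n := n)) //; apply: tab_avoid_nil.
Qed.

Fixpoint dom (s u : seq nat) : bool :=
  match u, s with
  | [::], _ => true
  | z :: u', x :: s' => (x < z) && dom s' u'
  | _, _ => false
  end.

Fixpoint stdtab (T : tab) : bool :=
  if T is row :: T' then
    [&& row != [::], sorted ltn row, dom row (head [::] T') & stdtab T']
  else true.

Lemma dom_nil s : dom s [::]. Proof. by case: s. Qed.

Lemma dom_rconsl s u M : dom s u -> dom (rcons s M) u.
Proof. by elim: s u => [|x s IH] [|z u] //= /andP[-> /IH]. Qed.

Lemma dom_rconsr s u M : dom s u -> size u < size s -> all (fun a => a < M) s ->
  dom s (rcons u M).
Proof.
elim: s u => [|x s IH] [|z u] //=; first by move=> _ _ /andP[-> _]; rewrite dom_nil.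
by move=> /andP[-> h] us /andP[_ hs]; apply: IH.
Qed.

(** While [s] is inserted, the first row consists of the letters [p] already in place and the
    remainder [u] of the old row. Each letter bumps the head of [u] as long as there is one, and so
    [u] is inserted into [T] in order. *)
Lemma rowfold_row s p u T : sorted ltn (p ++ s) -> sorted ltn u -> dom s u ->
  rowfold s ((p ++ u) :: T) = (p ++ s) :: rowfold u T.
Proof.
elim: s p u T => [|x s IH] p u T; first by case: u.
move=> ps su; have px : all (fun a => a < x) p.
  by move: ps; rewrite (sorted_pairwise ltn_trans) pairwise_cat => /and3P[/allrelP h _ _];
     apply/allP=> a ap; apply: h => //; rewrite mem_head.
have hp : has (fun a => x < a) p = false.
  by apply/negbTE/hasPn=> a /(allP px); lia.
have fp : [seq a <- p | x < a] = [::].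
  by apply/eqP; rewrite -size_eq0 size_filter -leqn0 leqNgt -has_count hp.
have ps' : sorted ltn (rcons p x ++ s) by rewrite cat_rcons.
case: u su => [|z u] su /=.
  move=> _; rewrite cats0 hp /= -cat_rcons.
  by have := IH (rcons p x) [::] T ps' isT (dom_nil s); rewrite cats0.
move=> /andP[xz hd]; rewrite has_cat /= xz orbT filter_cat fp /= xz /= map_cat /= eqxx.
have hu a : a \in u -> z < a.
  by move=> au; move: su => /= /(order_path_min ltn_trans)/allP; apply.
rewrite !map_id_in; last first.
- by move=> a /(allP px) ax; case: eqP => // az; lia.
- by move=> a /hu za; case: eqP => // az; lia.
by rewrite -!cat_rcons IH //; case: (u) su => //= b u' /andP[].
Qed.

(** Inserting a whole row displaces the first row intact, and this passes down the tableau; the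
    rows, read from the bottom up, thus pile up to [T]. *)
Lemma rowfold_reading T : stdtab T -> rowfold (flatten (rev T)) [::] = T.
Proof.
elim: T => //= row T IH /and4P[r0 sr hd hT].
rewrite rev_cons -cats1 flatten_cat /= cats0 /rowfold foldl_cat -!/(rowfold _ _) IH //.
elim: T row {IH} r0 sr hd hT => [|t T IH] row r0 sr hd /=.
  move=> _; case: row r0 sr {hd} => //= x s _ sr.
  exact: (@rowfold_row s [:: x] [::] [::] sr isT (dom_nil _)).
move=> /and4P[t0 st ht hT].
by rewrite (@rowfold_row row [::] t T sr st hd) /= IH.
Qed.

Lemma rev_readingE T : rev_reading T = rev (flatten (rev T)).
Proof. by rewrite rev_flatten map_rev revK. Qed.

Lemma stdtab_tab_add T i M : stdtab T -> below M T -> i <= size T ->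
  (0 < i -> nth 0 (map size T) i < nth 0 (map size T) i.-1) -> stdtab (tab_add T i M).
Proof.
elim: T i => [|row T IH] [|i] //= /and4P[r0 sr hd hT] /andP[hr hb] iT hi.
  rewrite /tab_add /= hT dom_rconsl // andbT.
  rewrite (_ : rcons row M != [::]); last by case: (row).
  rewrite (sorted_pairwise ltn_trans) -cats1 pairwise_cat -(sorted_pairwise ltn_trans) sr /= andbT.
  by apply/andP; split=> //; apply/allrelP=> a b ar; rewrite inE => /eqP ->; apply: (allP hr).
rewrite tab_addS /= r0 sr /=; apply/andP; split; last first.
  by apply: IH => // i0; move: hi => /(_ isT) /=; case: (i) i0.
case: i iT hi => [|i] iT hi; last first.
  by case: T hd iT {IH hT hb hi} => //= t T; rewrite tab_addS.
move: (hi isT) => /= {hi} hi; case: T hd hi {IH hT hb iT} => [|t T] /= hd hi.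
  by apply: (@dom_rconsr row [::]).
by apply: dom_rconsr.
Qed.

Lemma stdtab_tabn f n : chain f -> stdtab (tabn f n).
Proof.
move=> cf; elim: n => // n IH.
have [_ [E|[[i j] h]]] := cf.2 n; first by rewrite /= E eqxx.
have [-> iT] := tabn_cov cf h; apply: stdtab_tab_add; rewrite ?below_tabn //= tabn_shape //.
have [_ e] := cov_nth h; have [_ pm _ _] := h; case: i {h iT} e => // i e _.
have := leq_nth_part pm (leqnSn i); rewrite !e eqxx (_ : (i == i.+1) = false) /=; lia.
Qed.

(** * Column deletion as the inverse of column insertion *)

Lemma sorted_split x row : sorted ltn row -> has (fun a => x < a) row ->
  exists p z q, [/\ row = p ++ z :: q, all (fun a => a <= x) p, x < z
                  & all (fun a => z < a) q].
Proof.
elim: row => //= a row IH sr; case: (ltnP x a) => [xa _|ax /= hx].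
  by exists [::], a, row; split=> //; apply: order_path_min sr; apply: ltn_trans.
have [p [z [q [E hp xz hq]]]] := IH (path_sorted sr) hx.
by exists (a :: p), z, q; rewrite E /= ax.
Qed.

(** [bump_back] works from column [k] towards the first; splitting off the first column, which it
    changes last, allows induction along [rowins], which changes it first. *)
Lemma bump_backS row C k y : bump_back (row :: C) k.+1 y =
  let: (C', z) := bump_back C k y in
  let z' := last 0 [seq a <- row | a < z] in
  ([seq (if a == z' then z else a) | a <- row] :: C', z').
Proof. by elim: k C y => //= k IH C y; rewrite -IH. Qed.

(** Here [S] lists the columns. Inserting [x] bumps some [z] from the first of them; by induction
    deletion brings [z] back from the others, and the largest entry below [z] is then [x]. A column
    created by the insertion is left behind empty. *)
Lemma bump_back_rowins x S : all (sorted ltn) S -> uniq (flatten S) -> x \notin flatten S ->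
  let R := rowins x S in let c := newrow x S in let col := nth [::] R c in
  bump_back (set_nth [::] R c (take (size col).-1 col)) c (last 0 col)
  = (if c < size S then S else rcons S [::], x).
Proof.
elim: S x => //= row S IH x /andP[sr sS]; rewrite cat_uniq => /and3P[_ hd uS].
rewrite mem_cat negb_or => /andP[xr xS]; case: ifP => hx; last first.
  by rewrite /= size_rcons last_rcons -cats1 take_size_cat.
have [p [z [q [E hp xz hq]]]] := sorted_split sr hx.
have Ez : nth 0 [seq a <- row | x < a] 0 = z.
  rewrite E filter_cat (_ : [seq a <- p | x < a] = [::]) /= ?xz //.
  by rewrite -(filter_pred0 p); apply: eq_in_filter => a /(allP hp); rewrite /= leqNgt => /negbTE.
rewrite Ez [nth _ (_ :: _) _]/= [set_nth _ _ _ _]/= bump_backS.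
have zS : z \notin flatten S.
  by apply: contra hd => zS; apply/hasP; exists z => //; rewrite E mem_cat mem_head orbT.
have px a : a \in p -> a < x.
  move=> ap; rewrite ltn_neqAle (allP hp) // andbT; apply: contra xr => /eqP <-.
  by rewrite E mem_cat ap.
have zx : (z < x) = false by rewrite ltnNge (ltnW xz).
have Er : [seq (if a == z then x else a) | a <- row] = p ++ x :: q.
  rewrite E map_cat /= eqxx !map_id_in // => a.
    by move/(allP hq); case: eqP => // ->; rewrite ltnn.
  by move/px; case: eqP => // ->; rewrite zx.
have El : last 0 [seq a <- p ++ x :: q | a < z] = x.
  rewrite filter_cat /= xz (_ : [seq a <- q | a < z] = [::]) ?last_cat //.
  rewrite -(filter_pred0 q); apply: eq_in_filter => a /(allP hq) za.
  by rewrite ltnNge (ltnW za).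
rewrite IH // ltnS /= Er El map_cat /= eqxx !map_id_in -?E.
- by case: ifP.
- by move=> a /(allP hq); case: eqP => // ->; rewrite zx.
- by move=> a /px; case: eqP => // ->; rewrite ltnn.
Qed.

Lemma trans_rcons_nil S : trans (rcons S [::]) = trans S.
Proof.
rewrite /trans map_rcons foldr_rcons /= /maxn ltnn.
by apply: eq_map => j; rewrite filter_rcons.
Qed.

Lemma stdtab_sorted T : stdtab T -> all (sorted ltn) T.
Proof. by elim: T => //= row T IH /and4P[_ -> _ /IH]. Qed.

Lemma trans_transK f n : chain f -> trans (trans (tabn f n)) = tabn f n.
Proof.
move=> cf; rewrite !trans_tabn //; last exact: conj_chain.
by apply: eq_tabn => k _; rewrite conjK //; apply: chain_part.
Qed.

(** The chain [h] belongs to the transposed tableau, so its row [c] is the column from which the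
    corner is deleted. [trans] drops the empty column that may remain. *)
Lemma coldel_grow h x n c j : chain h -> 0 < x <= n -> h x = h x.-1 ->
  cov (h n) (c, j) (grow (pred1 x) h n) ->
  coldel (trans (tabn (grow (pred1 x) h) n)) c = (trans (tabn h n), x).
Proof.
move=> ch xn hx hc; have [x0 _] := andP xn; have cg := grow_chain ch x0 hx.
rewrite /coldel trans_transK //.
have Ec : newrow x (tabn h n) = c.
  apply: (@incr_nth_inj (h n)).
  by rewrite -{1}(tabn_shape n ch) -shape_rowins rowins_tabn // tabn_shape // (cov_incr hc).
have := @bump_back_rowins x (tabn h n) (stdtab_sorted (stdtab_tabn n ch)) (uniq_tabn n ch).
rewrite mem_tabn // hx eqxx andbF => /(_ isT) /=; rewrite Ec rowins_tabn // => ->.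
by case: ifP; rewrite ?trans_rcons_nil.
Qed.

(** * Labels below the antidiagonal and Sundaram's algorithm *)

Lemma cell_flat_top l m n c : cell l m n m c -> n = l.
Proof.
move=> h; inversion h as [|j p E1 E2 h1 E3|b E1 h1 E2|a h1 E1
  |a b p ab h1 h2 h3 h4 E1|i j j' p h1 E1 h2 E2]; subst => //.
- by move: (cov_neq h3); rewrite eqxx.
- by move: (cov_neq h2); rewrite eqxx.
Qed.

(** Lines that differ stay different to the right, so equality at the right end [k] goes back to
    every [j], and a cross would have made the lines differ. *)
Lemma strip_flat (f g : nat -> part) (c : nat -> bool) k :
  (forall j, j < k -> cell (f j) (g j) (f j.+1) (g j.+1) (c j.+1)) -> f k = g k ->
  forall j, j <= k -> f j = g j /\ (0 < j -> c j = false).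
Proof.
elim: k => [|k IH] h Ek j; first by rewrite leqn0 => /eqP->.
have hk := h k (ltnSn k); have [[_ [E|[b hb]]] _ _ _] := cell_steps hk; last first.
  by have [d hd] := cell_cov hk hb; move: (cov_neq hd); rewrite Ek eqxx.
rewrite leq_eqVlt => /orP[/eqP->|]; last by rewrite ltnS; apply: IH => // i ik; apply: h; lia.
split=> // _; case: (c k.+1) hk => // /cell_cross_inv[_ E1 [i hi]].
by move: (cov_neq hi); rewrite -Ek E1 eqxx.
Qed.

(** Lines that agree on the left border can separate only at a cross, and once separated they leave
    no room for another: rule F3 needs equal labels. *)
Lemma strip_cross (f g : nat -> part) (c : nat -> bool) k b :
  (forall j, j < k -> cell (f j) (g j) (f j.+1) (g j.+1) (c j.+1)) -> f 0 = g 0 ->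
  cov (f k) b (g k) ->
  exists x, [/\ 0 < x <= k, f x = f x.-1 & forall j, 0 < j <= k -> c j = (j == x)].
Proof.
elim: k b => [|k IH] b h E0 hb; first by move: (cov_neq hb); rewrite E0 eqxx.
have hk := h k (ltnSn k); have [[_ [E|[d hd]]] _ _ _] := cell_steps hk.
  exists k.+1; have hc : c k.+1.
    case: (c k.+1) hk => //; rewrite E => /cell_flat E1.
    by move: (cov_neq hb); rewrite E1 eqxx.
  rewrite hc in hk; have [_ E2 _] := cell_cross_inv hk; split=> // [|j jk]; first by lia.
  case: (eqVneq j k.+1) => [-> //|jk'].
  have jk1 : j <= k by lia.
  have [|_ -> //] := @strip_flat f g c k _ (esym E) j jk1; last by lia.
  by move=> i ik; apply: h; lia.
have [x [xk fx cx]] := IH d (fun j jk => h j (ltnW jk)) E0 hd.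
exists x; split=> // [|j jk]; first by lia.
case: (eqVneq j k.+1) => [->|jk']; last by apply: cx; lia.
rewrite (_ : (k.+1 == x) = false); last by lia.
case: (c k.+1) hk => // /cell_cross_inv[E1].
by move: (cov_neq hd); rewrite E1 eqxx.
Qed.

Lemma low0 mu x : x <= len mu -> low mu 0 x = conj (muk mu x).
Proof. by move=> xr; rewrite /low /at_ nth_mkseq. Qed.

Lemma low1 mu x : x <= len mu ->
  low mu 1 x = pmeet (conj (muk mu x)) (conj (muk mu x.+1)).
Proof. by move=> xr; rewrite /low /at_ nth_mkseq. Qed.

Lemma lowSS mu d x : x <= len mu ->
  low mu d.+2 x = (bwd (low mu d.+1 x) (low mu d.+1 x.+1) (low mu d x.+1)).1.
Proof. by move=> xr; rewrite {1}/low /at_ nth_mkseq. Qed.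

(* Labels of the points [(j, r - k)], made constant in [j] to the right of the antidiagonal. *)
Definition lowrow (mu : seq part) (k j : nat) : part := low mu (k - minn j k) (minn j k).

Lemma lowrow_beyond mu k j : k <= j -> lowrow mu k j = lowrow mu k k.
Proof. by move=> kj; rewrite /lowrow (minn_idPr kj) minnn. Qed.

Lemma lowrow_diag mu k : k <= len mu -> lowrow mu k k = conj (muk mu k).
Proof. by move=> kr; rewrite /lowrow minnn subnn low0. Qed.

Lemma lowrow_subdiag mu k : k < len mu ->
  lowrow mu k.+1 k = pmeet (conj (muk mu k)) (conj (muk mu k.+1)).
Proof.
move=> kr; rewrite /lowrow (minn_idPl (leqnSn k)) subSnn low1 //; lia.
Qed.

Lemma lowrow_bwd mu k j : j < k -> k < len mu ->
  (lowrow mu k.+1 j, lowcross mu k.+1 j.+1)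
  = bwd (lowrow mu k j) (lowrow mu k.+1 j.+1) (lowrow mu k j.+1).
Proof.
move=> jk kr; rewrite /lowcross /lowrow.
rewrite !(minn_idPl _); try lia.
have -> : k.+1 - j.+1 - 1 = k - j.+1 by lia.
have -> : k.+1 - j = (k - j.+1).+2 by lia.
have -> : k - j = (k - j.+1).+1 by lia.
have -> : k.+1 - j.+1 = (k - j.+1).+1 by lia.
by rewrite lowSS; [case: bwd | lia].
Qed.

Section Oscillating.

Variable mu : seq part.
Hypothesis mu_osc : osc_tableau mu.

Lemma muk0 : muk mu 0 = [::].
Proof. by case/and4P: mu_osc => _ /eqP. Qed.

Lemma muk_part k : is_part (muk mu k).
Proof.
case/and4P: mu_osc => _ _ /allP h _; rewrite /muk.
by case: (ltnP k (size mu)) => ks; [apply/h/mem_nth | rewrite nth_default].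
Qed.

Lemma muk_step k : k < len mu ->
  (exists b, cov (muk mu k) b (muk mu k.+1)) \/ (exists b, cov (muk mu k.+1) b (muk mu k)).
Proof.
case/and4P: mu_osc => s0 _ _ /(sortedP [::]) h kr.
have ks : k.+1 < size mu by move: kr; rewrite /len; lia.
case/orP: (h k ks) => hb; [left|right]; apply: one_boxP => //; exact: muk_part.
Qed.

Lemma pmeet_cov l b m : cov l b m -> pmeet l m = l /\ pmeet m l = l.
Proof.
move=> [p1 p2 _ e]; split; apply: eq_inp; rewrite ?pmeet_part // => c.
  by rewrite inp_pmeet e; case: inp.
by rewrite inp_pmeet e andbC; case: inp.
Qed.

Lemma lowrow_subdiag_step k : k < len mu ->
  step (lowrow mu k.+1 k) (lowrow mu k k) /\ step (lowrow mu k.+1 k) (lowrow mu k.+1 k.+1).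
Proof.
move=> kr; rewrite lowrow_subdiag // !lowrow_diag //; last exact: ltnW.
case: (muk_step kr) => -[[i j] /cov_conj h]; have [e1 e2] := pmeet_cov h.
  rewrite e1; split; last exact: cov_step h.
  exact/step_refl/conj_part/muk_part.
rewrite e2; split; first exact: cov_step h.
exact/step_refl/conj_part/muk_part.
Qed.

Lemma lowrow_strip k : k < len mu -> chain (lowrow mu k) ->
  (forall j, j <= k -> step (lowrow mu k.+1 j) (lowrow mu k j)) /\
  (forall j, j < k -> cell (lowrow mu k.+1 j) (lowrow mu k j)
      (lowrow mu k.+1 j.+1) (lowrow mu k j.+1) (lowcross mu k.+1 j.+1)).
Proof.
move=> kr [_ ck].
have key j : j < k -> step (lowrow mu k.+1 j.+1) (lowrow mu k j.+1) ->
    cell (lowrow mu k.+1 j) (lowrow mu k j)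
      (lowrow mu k.+1 j.+1) (lowrow mu k j.+1) (lowcross mu k.+1 j.+1).
  move=> jk s; have [l [c [E hc]]] := bwdP (ck j) s.
  by move: E; rewrite -lowrow_bwd // => -[-> ->].
(* The backward rules run from right to left, starting at the cell on the antidiagonal. *)
have st j : j <= k -> step (lowrow mu k.+1 (k - j)) (lowrow mu k (k - j)).
  elim: j => [_|j IH jk]; first by rewrite subn0; case: (lowrow_subdiag_step kr).
  have E : k - j = (k - j.+1).+1 by lia.
  have s := IH (ltnW jk); rewrite E in s.
  by case: (cell_steps (key _ _ s)); first lia.
have st' j : j <= k -> step (lowrow mu k.+1 j) (lowrow mu k j).
  by move=> jk; have := st (k - j); rewrite subKn //; apply; lia.
by split=> // j jk; apply: key => //; apply: st'.
Qed.

Lemma lowrow_chain k : k <= len mu -> chain (lowrow mu k).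
Proof.
elim: k => [|k IH] kr.
  have E j : lowrow mu 0 j = [::] by rewrite lowrow_beyond // lowrow_diag // muk0.
  by split=> // j; rewrite !E; apply: step_refl.
have ck := IH (ltnW kr); have [s1 s2] := lowrow_strip kr ck.
split.
  have [p0 [E|[b hb]]] := s1 0 (leq0n k); first by rewrite -E ck.1.
  by have [_ _ n e] := hb; have := e b; rewrite eqxx orbT ck.1 /inp nth_nil.
move=> j; case: (ltngtP j k) => jk.
- by case: (cell_steps (s2 j jk)).
- rewrite !(@lowrow_beyond mu k.+1) //; last exact: ltnW.
  by rewrite lowrow_diag //; apply/step_refl/conj_part/muk_part.
- by rewrite jk; case: (lowrow_subdiag_step kr).
Qed.

Lemma lowrow_cell k j : k < len mu -> j < k ->
  cell (lowrow mu k.+1 j) (lowrow mu k j)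
      (lowrow mu k.+1 j.+1) (lowrow mu k j.+1) (lowcross mu k.+1 j.+1).
Proof. by move=> kr jk; have [_ h] := lowrow_strip kr (lowrow_chain (ltnW kr)); apply: h. Qed.

(** An expansion leaves the labels of the two lines equal at [k], so by [strip_flat] the lines agree
    and the strip contains no cross. *)
Lemma lowrow_expand k b : k < len mu -> cov (muk mu k) b (muk mu k.+1) ->
  (forall j, j <= k -> lowrow mu k.+1 j = lowrow mu k j) /\
  (forall j, 0 < j <= k -> lowcross mu k.+1 j = false).
Proof.
case: b => [i j] kr /cov_conj hb; have [e _] := pmeet_cov hb.
have h := strip_flat (fun j => @lowrow_cell k j kr).
have E : lowrow mu k.+1 k = lowrow mu k k.
  by rewrite lowrow_subdiag // e lowrow_diag // ltnW.
by split=> n nk; have [] := h E n _; try lia; move=> // _ ->; lia.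
Qed.

(** A contraction makes the two lines differ at [k], so the strip has one cross, in column [x]; the
    upper line is then the lower one with [x] inserted, that is, [x] is deleted on the way down. *)
Lemma lowrow_contract k i j : k < len mu -> cov (muk mu k.+1) (i, j) (muk mu k) ->
  lowrow mu k.+1 k.+1 = lowrow mu k.+1 k /\
  exists x, [/\ 0 < x <= k, lowrow mu k.+1 x = lowrow mu k.+1 x.-1,
     forall n, 0 < n <= k -> lowcross mu k.+1 n = (n == x) &
     forall n, n <= k -> grow (pred1 x) (lowrow mu k.+1) n = lowrow mu k n].
Proof.
move=> kr /cov_conj hb; have [_ e] := pmeet_cov hb.
have ck := lowrow_chain (ltnW kr); have ck1 := lowrow_chain kr.
split; first by rewrite lowrow_subdiag // e lowrow_diag.
have hb' : cov (lowrow mu k.+1 k) (j, i) (lowrow mu k k).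
  by rewrite lowrow_subdiag // e lowrow_diag // ltnW.
have E0 : lowrow mu k.+1 0 = lowrow mu k 0 by rewrite ck.1 ck1.1.
have [x [xk fx cx]] := strip_cross (fun j => @lowrow_cell k j kr) E0 hb'.
exists x; split=> //; elim=> [|n IH] nk; first by rewrite ck.1.
rewrite /= IH; last exact: ltnW.
by have := lowrow_cell kr nk; rewrite cx // => /fwdE.
Qed.

(** Induction over the strips: an expansion puts [k.+1] at the end of the new line, and a
    contraction undoes an insertion along the strip. The labels are conjugate shapes, hence the
    [trans]. *)
Lemma sundaram_inv k : k <= len mu ->
  let st := foldl (sund_step mu) ([::], [::]) (iota 1 k) in
  st.2 = trans (tabn (lowrow mu k) k) /\
  forall i j, ((i, j) \in st.1) = [&& 0 < i, i < j, j <= k & lowcross mu j i].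
Proof.
elim: k => [|k IH] kr.
  by split=> // i j; rewrite in_nil; case: i => //= i; case: j => //= j; rewrite andbF.
move: (IH (ltnW kr)) => {IH} /=.
have -> : foldl (sund_step mu) (sund_step mu ([::], [::]) 1) (iota 2 k) =
  foldl (sund_step mu) ([::], [::]) (iota 1 k ++ [:: k.+1]).
  by rewrite -(iotaD 1 k 1) addn1.
rewrite -/(tabn (lowrow mu k.+1) k.+1).
set R := tabn (lowrow mu k.+1) k.+1.
rewrite foldl_cat /=; set st := foldl _ _ _; case: st => ps T /= [-> IH2].
rewrite /sund_step /=.
have ck := lowrow_chain (ltnW kr); have ck1 := lowrow_chain kr.
case: (muk_step kr) => -[[i0 j0] h].
  rewrite (cov_sumn h) leqnn (cov_diffrow h).1 /=.
  have [e1 e2] := lowrow_expand kr h.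
  have h' : cov (lowrow mu k.+1 k) (j0, i0) (lowrow mu k.+1 k.+1).
    by rewrite e1 // !lowrow_diag //; [exact: cov_conj | exact: ltnW].
  split.
    rewrite /R; have [-> _] := tabn_cov ck1 h'; rewrite (eq_tabn e1).
    rewrite (@trans_tab_add _ j0 i0 _ (lowrow mu k.+1 k.+1)) //.
    by rewrite tabn_shape // -e1.
  move=> i j; rewrite IH2; case: (eqVneq j k.+1) => [->|jk].
    by case: (posnP i) => [->|i0'] //=; case: (ltnP i k.+1) => ik //; rewrite e2 //; lia.
  by do 2!congr andb; congr andb; lia.
have -> : (sumn (muk mu k) < sumn (muk mu k.+1)) = false by rewrite (cov_sumn h); lia.
rewrite (cov_diffrow h).2 /=; have [h1 h2] := cov_nth h.
have -> : (nth 0 (muk mu k) i0).-1 = j0 by rewrite h2 h1 eqxx addn1.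
have [E [x [xk fx cx gx]]] := lowrow_contract kr h.
have hc : cov (lowrow mu k.+1 k) (j0, i0) (grow (pred1 x) (lowrow mu k.+1) k).
  by rewrite gx // -E !lowrow_diag //; [exact: cov_conj | exact: ltnW].
(* The old tableau arises from the new one by inserting [x], so [coldel_grow] yields both the output
   and the remaining tableau. *)
have Et : tabn (lowrow mu k) k = tabn (grow (pred1 x) (lowrow mu k.+1)) k.
  by apply: eq_tabn => n nk; rewrite gx.
rewrite Et (coldel_grow ck1 xk fx hc) /=; split; first by rewrite /R /= E eqxx.
move=> i j; rewrite mem_rcons inE IH2 xpair_eqE.
case: (eqVneq j k.+1) => [->|jk]; last by rewrite andbF /=; do 2!congr andb; congr andb; lia.
rewrite ltnn andbT leqnn !andbF orbF.
case: (posnP i) => [->|i0'] /=; first by lia.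
case: (ltnP i k.+1) => ik /=; last by lia.
by rewrite cx //; lia.
Qed.

Lemma sund_T_lowrow : sund_T mu = trans (tabn (lowrow mu (len mu)) (len mu)).
Proof. by case: (sundaram_inv (leqnn (len mu))). Qed.

Lemma mem_sund_pairs i j :
  ((i, j) \in sund_pairs mu) = [&& 0 < i, i < j, j <= len mu & lowcross mu j i].
Proof. by case: (sundaram_inv (leqnn (len mu))). Qed.

Lemma rob_crossE i j : rob_cross mu i j = is_pair (sund_pairs mu) i j.
Proof.
rewrite /rob_cross /is_pair !mem_sund_pairs.
case: (ltngtP i j) => ij; rewrite ?andbF ?orbF //=.
- by apply/and5P/and3P=> [[-> _ _ -> ->]|[-> jr ->]] //; split=> //; lia.
- by apply/and5P/and3P=> [[_ -> -> _ ->]|[-> jr ->]] //; split=> //; lia.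
Qed.

(** No missing entry [a <= k] reappears on a lower line: equal labels on the top edge of a cell
    force equal labels on its bottom edge, by [cell_flat_top]. *)
Lemma lowrow_stay k k' a : 0 < a <= k -> k <= k' -> k' <= len mu ->
  lowrow mu k a = lowrow mu k a.-1 -> lowrow mu k' a = lowrow mu k' a.-1.
Proof.
move=> ak kk' kr' E; elim: k' kk' kr' => [|k' IH] kk' kr'; first by lia.
case: (ltngtP k k'.+1) kk' => // [kk' _|<- //].
have {}IH := IH kk' (ltnW kr').
have ak' : a.-1 < k' by lia.
have := lowrow_cell kr' ak'; rewrite prednK; last by lia.
by rewrite IH => /cell_flat_top.
Qed.

(** In a pair [(x, k)] the entry [x] was deleted at step [k], and [k] never entered because that
    step was a contraction. Hence no letter of the involution is an entry of [sund_T mu]. *)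
Lemma lowrow_supp a : a \in pair_elems (sund_pairs mu) ->
  lowrow mu (len mu) a = lowrow mu (len mu) a.-1.
Proof.
case/flattenP=> s /mapP[[x k] hp ->]; move: hp; rewrite mem_sund_pairs => /and4P[x0 xk kr hc].
case: k xk kr hc => // k; rewrite ltnS => xk kr hc; rewrite !inE /= => /orP[/eqP->|/eqP->].
  apply: (@lowrow_stay k.+1) => //; first by lia.
  have xk' : x.-1 < k by lia.
  have := lowrow_cell kr xk'; rewrite prednK // hc.
  by case/cell_cross_inv.
apply: (@lowrow_stay k.+1) => //=.
case: (muk_step kr) => -[[i j] h]; last by case: (lowrow_contract kr h).
by have [_ /(_ x)] := lowrow_expand kr h; rewrite x0 xk hc => /(_ isT).
Qed.

End Oscillating.

(** * Labels above the antidiagonal *)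

Lemma tab_of_chain_tabn f n : tab_of_chain (mkseq f n.+1) = tabn f n.
Proof.
rewrite /tab_of_chain size_mkseq /=.
set F := fun _ _ => _.
suff h k : k <= n -> foldl F [::] (iota 1 k) = tabn f k by apply: h.
elim: k => // k IH kn; have -> : iota 1 k.+1 = iota 1 k ++ [:: k.+1].
  by rewrite -(iotaD 1 k 1) addn1.
rewrite foldl_cat IH; last exact: ltnW.
by rewrite /= /F -pred_Sn !nth_mkseq // ltnS ltnW.
Qed.

Lemma determines_tabn f n : chain f -> determines (mkseq f n.+1) (tabn f n).
Proof.
move=> cf; rewrite /determines tab_of_chain_tabn eqxx andbT.
apply/and4P; split; rewrite ?size_mkseq //.
- by rewrite nth_mkseq // cf.1.
- by apply/allP=> l /mapP[k _ ->]; apply: chain_part.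
apply/allP=> -[|k]; rewrite mem_iota // add1n ltnS => kn.
rewrite -pred_Sn !nth_mkseq //; last exact: ltnW.
by have [_ [->|[b hb]]] := cf.2 k; rewrite ?eqxx // (cov_one_box hb) orbT.
Qed.

Lemma eq_mkseq_lt (T : Type) (f g : nat -> T) n : (forall k, k < n -> f k = g k) ->
  mkseq f n = mkseq g n.
Proof.
move=> fg; rewrite /mkseq; elim: n fg => // n IH fg.
rewrite -addn1 iotaD !map_cat IH /=; first by rewrite fg.
by move=> k kn; apply: fg; lia.
Qed.

(** Lines of the grid from the bottom line [f] upwards; the cells between heights [y'] and [y'.+1]
    form row [len mu - y']. *)
Fixpoint grows (mu : seq part) (f : nat -> part) (y : nat) : nat -> part :=
  if y is y'.+1 then grow (rob_cross mu (len mu - y')) (grows mu f y') else f.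

Lemma grid_grows mu x y : x <= len mu -> y <= len mu ->
  at_ (grid mu x) y = grows mu (fun=> [::]) y x.
Proof.
elim: x y => [|x IH] y xr yr.
  by rewrite /at_ nth_nseq ltnS yr; case: y yr.
rewrite /= /gcol; set F := fun _ _ => _.
have h n : n <= len mu -> size (foldl F [:: [::]] (iota 0 n)) = n.+1 /\
  forall k, k <= n -> nth [::] (foldl F [:: [::]] (iota 0 n)) k = grows mu (fun=> [::]) k x.+1.
  elim: n => [|n IHn] nr; first by split=> // k; rewrite leqn0 => /eqP ->.
  have [s1 s2] := IHn (ltnW nr).
  have -> : iota 0 n.+1 = iota 0 n ++ [:: n] by rewrite -(iotaD 0 n 1) addn1.
  rewrite foldl_cat /= {1 3}/F size_rcons s1; split=> // k kn.
  rewrite nth_rcons s1; case: (ltngtP k n.+1) kn => // [kn|->] _; first exact: s2.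
  have e1 : nth [::] (grid mu x) n = _ := IH n (ltnW xr) (ltnW nr).
  have e2 : nth [::] (grid mu x) n.+1 = _ := IH n.+1 (ltnW xr) nr.
  by rewrite /at_ s2 // e1 e2.
by case: (h (len mu) (leqnn _)) => _; apply.
Qed.

Section Grid.

Variable mu : seq part.
Hypothesis mu_osc : osc_tableau mu.
Local Notation r := (len mu).
Local Notation G := (grows mu (lowrow mu r)).

(** Below the antidiagonal the forward rules rebuild what the backward rules produced, so one
    forward growth from the bottom line describes the whole diagram. *)
Lemma grows_low k j : k <= r -> j <= k -> G (r - k) j = lowrow mu k j.
Proof.
have [d] := ubnP (r - k); elim: d k j => // d IH k j hd kr jk.
case: (ltngtP k r) kr => // [kr _|-> _]; last by rewrite subnn.
have -> : r - k = (r - k.+1).+1 by lia.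
have E : r - (r - k.+1) = k.+1 by lia.
rewrite /= E; elim: j jk => [|j IHj] jk; first by rewrite (lowrow_chain mu_osc (ltnW kr)).1.
rewrite /= IHj; last exact: ltnW.
rewrite !IH; try lia.
have -> : rob_cross mu k.+1 j.+1 = lowcross mu k.+1 j.+1.
  have jr : j < r by apply: ltn_trans jk kr.
  by rewrite /rob_cross kr jr (_ : j.+1 < k.+1).
exact/fwdE/lowrow_cell.
Qed.

(** [highpair] carries two successive levels, so the induction on [e] has to speak of both; it
    starts from [grows_low] on the antidiagonal and one level below. *)
Lemma high_grows e x : e <= x -> x <= r -> high mu e x = G (r + e - x) x.
Proof.
have low_k k j : j <= k -> k <= r -> low mu (k - j) j = G (r - k) j.
  by move=> jk kr; rewrite grows_low // /lowrow (minn_idPl jk).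
suff h : (forall x, e <= x -> x <= r -> high mu e x = G (r + e - x) x) /\
   (forall x, e <= x -> x < r -> at_ (highpair mu e).1 x = G (r + e - x.+1) x).
  by move=> ex xr; apply: h.1.
elim: e {x} => [|e [IH1 IH2]].
  split=> x _ xr; first by have := low_k x x (leqnn x) xr; rewrite subnn addn0.
  by have := low_k x.+1 x (leqnSn x) xr; rewrite subSnn addn0.
split=> x ex xr; last first.
  rewrite [at_ _ _](_ : _ = high mu e x) // IH1; try lia.
  by congr (G _ x); lia.
case: x ex xr => // x ex xr.
rewrite /high /at_ nth_mkseq // -!/(at_ _ _) -!/(high mu e _) /=.
rewrite IH2 // !IH1 //; try lia.
have -> : r + e.+1 - x.+1 = (r + e - x.+1).+1 by lia.
have -> : r + e - x = (r + e - x.+1).+1 by lia.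
by rewrite /=; have -> : r - (r + e - x.+1) = x.+1 - e by lia.
Qed.

End Grid.

(** * Rows of the grid as column insertions of the letters of the involution *)

Lemma mem_pair_elems ps i : (i \in pair_elems ps) = has (fun p => (i == p.1) || (i == p.2)) ps.
Proof. by elim: ps => //= p ps IH; rewrite !inE IH orbA. Qed.

Lemma is_pair_mem ps i j : is_pair ps i j -> i \in pair_elems ps.
Proof.
rewrite mem_pair_elems => /orP[h|h]; apply/hasP; first by exists (i, j); rewrite //= eqxx.
by exists (j, i); rewrite //= eqxx orbT.
Qed.

Lemma is_pairC ps i j : is_pair ps i j = is_pair ps j i.
Proof. by rewrite /is_pair orbC. Qed.

Lemma is_pair_partner ps i j : fpf_involution ps ->
  is_pair ps i j = (i \in pair_elems ps) && (partner ps i == j).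
Proof.
rewrite /fpf_involution; elim: ps => // -[a b] ps IH /=.
rewrite inE negb_or -/(pair_elems ps) => /and3P[/andP[ab ha] hb u].
have not_mem k k' : k \notin pair_elems ps -> is_pair ps k k' = false.
  by move=> hk; apply: contraNF hk; apply: is_pair_mem.
have -> : is_pair ((a, b) :: ps) i j =
    [|| (i == a) && (j == b), (j == a) && (i == b) | is_pair ps i j].
  by rewrite /is_pair !inE !xpair_eqE -!orbA; congr orb; rewrite orbCA.
rewrite /= !inE (eq_sym a i) (eq_sym b i).
case: (eqVneq i a) => [->|ia] /=.
  by rewrite (negPf ab) andbF not_mem // !orbF eq_sym.
case: (eqVneq i b) => [->|ib] /=; last by rewrite andbF IH.
by rewrite andbT not_mem // !orbF eq_sym.
Qed.

(** The images under the involution of the indices in [L]; an index outside its support belongs to a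
    row of cells without a cross and contributes nothing. *)
Definition partner_word (ps : seq (nat * nat)) (L : seq nat) : seq nat :=
  [seq partner ps i | i <- L & i \in pair_elems ps].

Section Rows.

Variable mu : seq part.
Hypothesis mu_osc : osc_tableau mu.
Local Notation r := (len mu).
Local Notation ps := (sund_pairs mu).
Hypothesis ps_fpf : fpf_involution ps.

Lemma is_pair_bounds i j : is_pair ps i j -> 0 < i <= r /\ 0 < j <= r.
Proof.
rewrite -rob_crossE // => /and5P[-> -> -> ->]; by split.
Qed.

Lemma partnerP i : i \in pair_elems ps -> is_pair ps i (partner ps i).
Proof. by move=> hi; rewrite is_pair_partner // hi eqxx. Qed.

Lemma partner_supp i : i \in pair_elems ps ->
  partner ps i \in pair_elems ps /\ partner ps (partner ps i) = i.
Proof.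
move/partnerP; rewrite is_pairC => /[dup] /is_pair_mem h.
by rewrite is_pair_partner // h => /eqP.
Qed.

Lemma mem_partner_word L x : x \in partner_word ps L ->
  x \in pair_elems ps /\ 0 < x <= r.
Proof.
case/mapP=> i; rewrite mem_filter => /andP[hi _] ->.
by split; [case: (partner_supp hi) | case: (is_pair_bounds (partnerP hi))].
Qed.

Lemma uniq_partner_word L : uniq L -> uniq (partner_word ps L).
Proof.
move=> uL; rewrite map_inj_in_uniq ?filter_uniq // => i j.
rewrite !mem_filter => /andP[hi _] /andP[hj _] E.
by rewrite -(partner_supp hi).2 E (partner_supp hj).2.
Qed.

Lemma eq_chain f g : f =1 g -> chain f -> chain g.
Proof. by move=> e [f0 fS]; split=> [|k]; rewrite -!e. Qed.

Definition Gfold (L : seq nat) (f : nat -> part) : nat -> part :=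
  foldl (fun g i => grow (rob_cross mu i) g) f L.

Lemma grows_Gfold f y : grows mu f y = Gfold [seq r - t | t <- iota 0 y] f.
Proof.
elim: y => // y IH; have -> : iota 0 y.+1 = iota 0 y ++ [:: y].
  by rewrite -(iotaD 0 y 1) addn1.
by rewrite /Gfold map_cat foldl_cat /= IH.
Qed.

Lemma eq_Gfold L f g : f =1 g -> Gfold L f =1 Gfold L g.
Proof.
elim: L f g => //= i L IH f g e; apply: IH => k.
by apply: (eq_grow (n := k)).
Qed.

(** Row [i] of cells holds a cross in column [partner ps i] if [i] is in the support and none
    otherwise; since labels are conjugate shapes, passing it column-inserts that letter or changes
    nothing. *)
Lemma Gfold_colfold L f : chain f -> uniq (partner_word ps L) ->
  (forall x, x \in partner_word ps L -> f x = f x.-1) ->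
  chain (Gfold L f) /\
  tabn (fun k => conj (Gfold L f k)) r
  = colfold (partner_word ps L) (tabn (fun k => conj (f k)) r).
Proof.
elim: L f => //= i L IH f cf; rewrite /partner_word /=; case: ifP => hi /= uw fw; last first.
  have e : grow (rob_cross mu i) f =1 f.
    move=> k; apply: (grow_stay (n := k)) => // j _.
    rewrite rob_crossE //; apply: contraFF hi; exact: is_pair_mem.
  have [c1 c2] := IH f cf uw fw; have e' := eq_Gfold L e; split.
    exact: eq_chain (fsym e') c1.
  by rewrite -c2; apply: eq_tabn => k _; rewrite e'.
set x := partner ps i in uw fw *.
have xr : 0 < x <= r by case: (is_pair_bounds (partnerP hi)).
have [x0 _] := andP xr.
have fx : f x = f x.-1 by apply: fw; rewrite mem_head.
have e : grow (rob_cross mu i) f =1 grow (pred1 x) f.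
  move=> k; apply: (eq_grow (n := k)) => // j _.
  by rewrite rob_crossE // is_pair_partner // hi eq_sym.
clearbody x.
have cg := grow_chain cf x0 fx; have [xw uw'] := andP uw.
have [|c1 c2] := IH _ cg uw'.
  move=> y yw; have [_ /andP[y0 _]] := mem_partner_word yw.
  apply: grow_at => //; last by apply: fw; rewrite inE yw orbT.
  by apply: contraNneq xw => ->.
have e' := eq_Gfold L e; split; first exact: eq_chain (fsym e') c1.
rewrite (eq_tabn (g := fun k => conj (Gfold L (grow (pred1 x) f) k))); last first.
  by move=> k _; rewrite e'.
rewrite c2 /colfold; congr foldl.
rewrite colins_tabn ?fx //; last exact: conj_chain.
apply: eq_tabn => k _; congr conj; apply: (eq_grow (n := k)) => // j _.
by rewrite conjK //; apply: chain_part.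
Qed.

End Rows.

Lemma mem_rowins x T a : a \in flatten (rowins x T) -> a = x \/ a \in flatten T.
Proof.
elim: T x => [|row T IH] x /=; first by rewrite inE => /eqP; left.
case: ifP => hx /=; rewrite !mem_cat; last first.
  by rewrite mem_rcons inE -orbA => /orP[/eqP|->]; [left | right].
case/orP=> [/mapP[b br ->]|/IH[->|aT]].
- by case: ifP => _; [left | right; rewrite br].
- by right; rewrite (nth_filter_has hx).2.
- by right; rewrite aT orbT.
Qed.

Lemma mem_rowfold w T a : a \in flatten (rowfold w T) -> a \in w \/ a \in flatten T.
Proof.
elim: w T => [|x w IH] T /=; first by right.
case/IH=> [aw|/mem_rowins[->|]]; rewrite ?inE ?eqxx ?aw ?orbT; auto.
Qed.

Lemma mem_flatten_rev (T : tab) : flatten (rev T) =i flatten T.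
Proof.
by move=> a; apply/flattenP/flattenP=> -[s sT as_]; exists s; rewrite // ?mem_rev // -mem_rev.
Qed.

Lemma uniq_flatten_rev (T : tab) : uniq (flatten (rev T)) = uniq (flatten T).
Proof. by apply/perm_uniq/perm_flatten; rewrite perm_rev. Qed.

Lemma filter_iota_supp ps n : fpf_involution ps ->
  (forall a, a \in pair_elems ps -> 0 < a <= n) ->
  [seq a <- iota 1 n | a \in pair_elems ps] = supp ps.
Proof.
move=> hps hb; apply: (irr_sorted_eq ltn_trans ltnn).
- by apply: sorted_filter (iota_ltn_sorted _ _); apply: ltn_trans.
- by rewrite ltn_sorted_uniq_leq sort_uniq -/(fpf_involution ps) hps (sort_sorted leq_total).
move=> a; rewrite mem_filter mem_sort mem_iota add1n ltnS.
by case: (boolP (a \in pair_elems ps)) => // /hb ->.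
Qed.

Lemma rev_iota1 n : [seq n - t | t <- iota 0 n] = rev (iota 1 n).
Proof.
apply: (@eq_from_nth _ 0) => [|i]; rewrite size_map size_iota ?size_rev ?size_iota // => hi.
rewrite (nth_map 0) ?size_iota // nth_iota // nth_rev ?size_iota // nth_iota; lia.
Qed.

(** [T] is the row insertion tableau of its own reading word, so commutation turns column insertion
    of [rev v] into [T] into row insertion of that word into the tableau of [v] ([key]). The word
    [w] and the reading word of [I] have the same tableau [I]. *)
Lemma colfold_rev_reading f w n : chain f -> uniq w ->
  (forall x, x \in w -> 0 < x <= n /\ f x = f x.-1) ->
  colfold (rev_reading (rowfold w [::])) (tabn f n) = colfold (rev w) (tabn f n).
Proof.
move=> cf uw hw; set T := tabn f n; set I := rowfold w [::].
have wn x : x \in w -> 0 < x <= n by case/hw.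
have [g [cg Eg _]] : tab_avoid n I [::].
  by apply: tab_avoid_rowfold; rewrite cats0 //; apply: tab_avoid_nil.
have stI : stdtab I by rewrite Eg; apply: stdtab_tabn.
have ET : rowfold (flatten (rev T)) [::] = T by rewrite rowfold_reading ?stdtab_tabn.
have wT x : x \in w -> x \notin flatten T.
  by case/hw=> _ E; rewrite mem_tabn // E eqxx andbF.
have key v : uniq v -> {subset v <= w} ->
    colfold (rev v) T = rowfold (flatten (rev T)) (rowfold v [::]).
  move=> uv vw; rewrite -{1}ET.
  have u : uniq (rev v ++ flatten (rev T)).
    rewrite cat_uniq rev_uniq uv uniq_flatten_rev uniq_tabn // andbT.
    apply/hasPn=> a; rewrite mem_flatten_rev /= mem_rev; apply: contraL => /vw/wT //.
  rewrite (colfold_rowfold (n := n)) //; last first.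
    apply: tab_avoid_nil => a; rewrite mem_cat mem_rev mem_flatten_rev.
    by case/orP=> [/vw/wn//|]; rewrite mem_tabn // => /andP[].
  by rewrite (colfold_rev (n := n)) // => a /vw/wn.
have vw : {subset flatten (rev I) <= w}.
  by move=> a; rewrite mem_flatten_rev => /mem_rowfold[].
rewrite rev_readingE !key //; first by rewrite rowfold_reading.
by rewrite uniq_flatten_rev Eg uniq_tabn.
Qed.

Theorem theorem7p4 (mu : seq (seq nat)) :
  osc_tableau mu ->
  fpf_involution (sund_pairs mu) ->
  [/\ A_Rob mu = supp (sund_pairs mu),
      (forall i j : nat, rob_cross mu i j = is_pair (sund_pairs mu) i j),
      determines (T_chain mu) (sund_T mu),
      determines (I_chain mu) (I_tab mu)
    & determines (Q_chain mu) (Q_tab mu)].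
Proof.
move=> osc fpf; set ps := sund_pairs mu; set r := len mu.
have bnd a : a \in pair_elems ps -> 0 < a <= r.
  by move/(partnerP fpf)/(is_pair_bounds osc) => [].
have Esupp := filter_iota_supp fpf bnd.
set w := [seq partner ps a | a <- supp ps].
(* Heights 0, ..., r - 1 correspond to the rows r, ..., 1 of cells, so the diagram meets the letters
   in reverse order. *)
have Ew : partner_word ps [seq r - t | t <- iota 0 r] = rev w.
  by rewrite rev_iota1 /partner_word filter_rev Esupp map_rev.
have uw : uniq (rev w).
  by rewrite -Ew uniq_partner_word // rev_iota1 rev_uniq iota_uniq.
have mw x : x \in rev w -> x \in pair_elems ps by rewrite -Ew => /(mem_partner_word osc fpf)[].
have cT := lowrow_chain osc (leqnn r).
have cT' := conj_chain cT.
have ET : sund_T mu = tabn (fun k => conj (lowrow mu r k)) r.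
  by rewrite sund_T_lowrow // trans_tabn.
have EI : I_tab mu = rowfold w [::] by [].
split.
- rewrite -Esupp; apply: eq_in_filter => j; rewrite mem_iota add1n ltnS => jr.
  apply/hasP/idP=> [[i _]|hj]; first by rewrite rob_crossE // is_pairC; apply: is_pair_mem.
  have hp := partnerP fpf hj; have [_ pr] := is_pair_bounds osc hp.
  by exists (partner ps j); [rewrite mem_iota add1n ltnS | rewrite rob_crossE // is_pairC].
- exact: rob_crossE.
- rewrite /T_chain (eq_mkseq_lt (g := fun k => conj (lowrow mu r k))) => [|k kr].
    by rewrite ET; apply: determines_tabn.
  by rewrite /lowrow (minn_idPl _).
- have c0 : chain (fun=> [::]) by split=> // k; apply: step_refl.
  have [||c1 c2] := Gfold_colfold osc fpf (L := [seq r - t | t <- iota 0 r]) c0; rewrite ?Ew //.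
  rewrite -grows_Gfold Ew in c1 c2.
  rewrite /I_chain (eq_mkseq_lt (g := fun k => conj (grows mu (fun=> [::]) r k))) => [|k kr].
    rewrite EI -(colfold_rev (n := r)); last 2 first.
    - by rewrite -rev_uniq.
    - by move=> x; rewrite -mem_rev => /mw/bnd.
    have E0 : tabn (fun k => conj ((fun=> [::]) k)) r = [::] by elim: (r).
    by rewrite -E0 -c2; apply/determines_tabn/conj_chain.
  by rewrite /nuI grid_grows.
have fw x : x \in rev w -> lowrow mu r x = lowrow mu r x.-1 by move/mw/(lowrow_supp osc).
have [||c1 c2] := Gfold_colfold osc fpf (L := [seq r - t | t <- iota 0 r]) cT; rewrite ?Ew //.
rewrite -grows_Gfold Ew in c1 c2.
rewrite /Q_chain (eq_mkseq_lt (g := fun k => conj (grows mu (lowrow mu r) r k))) => [|k kr].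
  (* The diagram inserts [rev w] into [sund_T mu], whereas [Q_tab] inserts the reverse reading word
     of [I_tab mu]; both give the same tableau. *)
  have -> : Q_tab mu = colfold (rev w) (sund_T mu).
    rewrite /Q_tab EI ET -/(colfold _ _); apply: colfold_rev_reading => //.
      by rewrite -rev_uniq.
    by move=> x; rewrite -mem_rev => xw; rewrite (bnd _ (mw _ xw)) fw.
  by rewrite ET -c2; apply/determines_tabn/conj_chain.
by rewrite /kappa high_grows // addnK.
Qed.
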